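(* Work in $\mathsf{ZF}$ (without the axiom of choice). For every infinite set $A$ and all natural numbers $m,n$ with $m\geq n+2$, there is an injection from $\mathcal{S}_n(A)$ into $\mathcal{S}_m(A)$.
   Context: For a permutation $s$ of a set $A$, $\mathrm{mov}(s)=\{a\in A\mid s(a)\neq a\}$, and $\mathcal{S}_n(A)$ is the set of permutations $s$ of $A$ with $|\mathrm{mov}(s)|=n$. *)

(* Defs.v *)
(* "Work in ZF" is rendered as truth in every model of first-order ZF in the
   language {=, ∈}.  Separation and replacement range only over first-order
   formulas with parameters (not over arbitrary predicates), so that choice
   principles of the ambient type theory give no choice inside the model. *)

Record set_structure : Type := SetStructure {
  carrier :> Type;
  mem : carrier -> carrier -> Prop
}.

Arguments mem {_} _ _.

Declare Scope zf_scope.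
Open Scope zf_scope.
Notation "x ∈ y" := (mem x y) (at level 70, no associativity) : zf_scope.

(* De Bruijn indices: under a quantifier, index 0 is the bound variable. *)
Inductive formula : Type :=
  | Feq (i j : nat)
  | Fmem (i j : nat)
  | Fbot
  | Fimp (p q : formula)
  | Fand (p q : formula)
  | For (p q : formula)
  | Fall (p : formula)
  | Fex (p : formula).

Definition scons {V : Type} (x : V) (e : nat -> V) (i : nat) : V :=
  match i with O => x | S j => e j end.

Fixpoint sat {V : set_structure} (e : nat -> V) (p : formula) : Prop :=
  match p with
  | Feq i j => e i = e j
  | Fmem i j => e i ∈ e j
  | Fbot => False
  | Fimp p q => sat e p -> sat e q
  | Fand p q => sat e p /\ sat e q
  | For p q => sat e p \/ sat e q
  | Fall p => forall x : V, sat (scons x e) p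
  | Fex p => exists x : V, sat (scons x e) p
  end.

Definition is_empty {V : set_structure} (x : V) : Prop :=
  forall z, ~ z ∈ x.

(* y = x ∪ {x} *)
Definition is_succ {V : set_structure} (x y : V) : Prop :=
  forall z, z ∈ y <-> z ∈ x \/ z = x.

Definition inductive {V : set_structure} (I : V) : Prop :=
  (exists o, is_empty o /\ o ∈ I) /\
  (forall x, x ∈ I -> exists y, is_succ x y /\ y ∈ I).

Record ZF (V : set_structure) : Prop := {
  ZF_extensionality :
    forall a b : V, (forall x, x ∈ a <-> x ∈ b) -> a = b;
  ZF_foundation :
    forall a : V, (exists x, x ∈ a) ->
    exists x, x ∈ a /\ (forall y, y ∈ x -> ~ y ∈ a);
  ZF_pairing :
    forall a b : V, exists c, forall x, x ∈ c <-> x = a \/ x = b;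
  ZF_union :
    forall a : V, exists b, forall x, x ∈ b <-> exists y, x ∈ y /\ y ∈ a;
  ZF_power :
    forall a : V, exists b, forall x, x ∈ b <-> (forall y, y ∈ x -> y ∈ a);
  ZF_infinity :
    exists I : V, inductive I;
  ZF_separation :
    forall (p : formula) (e : nat -> V) (a : V),
    exists b, forall x, x ∈ b <-> x ∈ a /\ sat (scons x e) p;
  ZF_replacement :
    forall (p : formula) (e : nat -> V) (a : V),
    (forall x y y', x ∈ a ->
       sat (scons x (scons y e)) p -> sat (scons x (scons y' e)) p -> y = y') ->
    exists b, forall y,
      y ∈ b <-> exists x, x ∈ a /\ sat (scons x (scons y e)) p
}.

(* n ∈ ω, where ω is the least inductive set. *)
Definition is_natural {V : set_structure} (n : V) : Prop :=
  forall I, inductive I -> n ∈ I.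

(* n + 2 <= m for von Neumann naturals, whose strict order is ∈. *)
Definition add2_le {V : set_structure} (n m : V) : Prop :=
  exists n1 n2, is_succ n n1 /\ is_succ n1 n2 /\ (n2 ∈ m \/ n2 = m).

Definition is_upair {V : set_structure} (x y p : V) : Prop :=
  forall z, z ∈ p <-> z = x \/ z = y.

(* p is the Kuratowski pair {{x}, {x, y}}. *)
Definition is_opair {V : set_structure} (x y p : V) : Prop :=
  exists u v, is_upair x x u /\ is_upair x y v /\ is_upair u v p.

(* (x, y) ∈ f *)
Definition maps {V : set_structure} (f x y : V) : Prop :=
  exists p, is_opair x y p /\ p ∈ f.

Definition is_function {V : set_structure} (f X Y : V) : Prop :=
  (forall p, p ∈ f -> exists x y, x ∈ X /\ y ∈ Y /\ is_opair x y p) /\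
  (forall x, x ∈ X -> exists y, maps f x y) /\
  (forall x y y', maps f x y -> maps f x y' -> y = y').

Definition is_injection {V : set_structure} (f X Y : V) : Prop :=
  is_function f X Y /\
  (forall x x' y, maps f x y -> maps f x' y -> x = x').

Definition is_bijection {V : set_structure} (f X Y : V) : Prop :=
  is_injection f X Y /\
  (forall y, y ∈ Y -> exists x, maps f x y).

Definition equinumerous {V : set_structure} (X Y : V) : Prop :=
  exists f, is_bijection f X Y.

Definition infinite {V : set_structure} (A : V) : Prop :=
  ~ exists n, is_natural n /\ equinumerous A n.

(* M = mov(s) *)
Definition is_mov {V : set_structure} (A s M : V) : Prop :=
  forall a, a ∈ M <-> a ∈ A /\ exists b, maps s a b /\ b <> a.

(* P = S_n(A), the set of permutations s of A with |mov(s)| = n. *)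
Definition is_perms_moving {V : set_structure} (n A P : V) : Prop :=
  forall s, s ∈ P <->
    is_bijection s A A /\ exists M, is_mov A s M /\ equinumerous M n.

(* Main.v *)
From Stdlib Require Import Arith Classical ClassicalEpsilon.
Require Import Defs.

(* Fix distinct points f(0), ..., f(N-1) of A, with N large compared to n, and
   let U be the set of i < N such that s moves f(i).  There is an injective way
   of adding one element to small subsets of N: reading elements as opening and
   non-elements as closing brackets, turn the last unmatched closing bracket into
   an opening one; it is recovered as the last position at which no bracket is
   pending.  Adding two or three elements in this way and composing s with a cycle
   on the corresponding points of A, which s fixes, gives injections of S_n(A) into
   S_{n+2}(A) and S_{n+3}(A): the set of moved points determines U, then the cycle,
   then s.  The general case follows by composition.

   Since separation and replacement are available only for first-order formulas
   and the naturals of V may be nonstandard, every set, recursion and induction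
   below comes with a proof that the predicate involved is definable. *)

(** * Definable predicates and functions *)

Fixpoint rename (r : nat -> nat) (p : formula) : formula :=
  match p with
  | Feq i j => Feq (r i) (r j)
  | Fmem i j => Fmem (r i) (r j)
  | Fbot => Fbot
  | Fimp p q => Fimp (rename r p) (rename r q)
  | Fand p q => Fand (rename r p) (rename r q)
  | For p q => For (rename r p) (rename r q)
  | Fall p => Fall (rename (scons 0 (fun i => S (r i))) p)
  | Fex p => Fex (rename (scons 0 (fun i => S (r i))) p)
  end.

Lemma sat_rename {V : set_structure} (p : formula) :
  forall (r : nat -> nat) (e e' : nat -> V),
  (forall i, e' (r i) = e i) -> (sat e' (rename r p) <-> sat e p).
Proof.
  induction p; intros r e e' H; simpl.
  1,2: rewrite !H; tauto.
  - tauto.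
  - rewrite (IHp1 r e e' H), (IHp2 r e e' H); tauto.
  - rewrite (IHp1 r e e' H), (IHp2 r e e' H); tauto.
  - rewrite (IHp1 r e e' H), (IHp2 r e e' H); tauto.
  - split; intros K x; apply (IHp (scons 0 (fun i => S (r i))) (scons x e) (scons x e'));
      auto; intros [|i]; simpl; auto.
  - split; intros [x K]; exists x;
      apply (IHp (scons 0 (fun i => S (r i))) (scons x e) (scons x e'));
      auto; intros [|i]; simpl; auto.
Qed.

(** Case distinction decided classically in the metatheory; by [DT_ite] it is definable as soon as
    its condition and both branches are. *)
Definition ite {X : Type} (P : Prop) (x y : X) : X :=
  if excluded_middle_informative P then x else y.

Lemma ite_true {X : Type} (P : Prop) (x y : X) : P -> ite P x y = x.
Proof. unfold ite; destruct excluded_middle_informative; tauto. Qed.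

Lemma ite_false {X : Type} (P : Prop) (x y : X) : ~ P -> ite P x y = y.
Proof. unfold ite; destruct excluded_middle_informative; tauto. Qed.

Section Definability.
Context {V : set_structure}.

Definition value (e : nat -> V) (v : nat + V) : V :=
  match v with inl i => e i | inr c => c end.

(* The assignment [T] says which free variables of [p] denote entries of the
   environment and which are parameters from [V]. *)
Definition D (P : (nat -> V) -> Prop) : Prop :=
  exists (p : formula) (T : nat -> nat + V),
  forall e, P e <-> sat (fun i => value e (T i)) p.

(** A term counts as definable through its graph: index 0 holds the value, so the environment of the
    term moves up by one. *)
Definition DT (t : (nat -> V) -> V) : Prop :=
  D (fun e => e 0 = t (fun i => e (S i))).

Lemma D_ext (P Q : (nat -> V) -> Prop) :
  (forall e, Q e <-> P e) -> D P -> D Q.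
Proof.
  intros H (p & T & K); exists p, T; intro e; rewrite H; apply K.
Qed.

(** Excluded middle in the metatheory makes a proposition that ignores the environment equivalent to
    truth or to falsity. *)
Lemma D_const (P : Prop) : D (fun _ => P).
Proof.
  destruct (classic P) as [H|H].
  - exists (Fimp Fbot Fbot), (fun _ => inl 0); simpl; tauto.
  - exists Fbot, (fun _ => inl 0); simpl; tauto.
Qed.

Lemma D_rename (r : nat -> nat) (P : (nat -> V) -> Prop) :
  D P -> D (fun e => P (fun i => e (r i))).
Proof.
  intros (p & T & K).
  exists p, (fun i => match T i with inl j => inl (r j) | inr c => inr c end).
  intro e; rewrite K.
  rewrite <- (sat_rename p (fun i => i) (fun i => value (fun i => e (r i)) (T i))
    (fun i => value e (match T i with inl j => inl (r j) | inr c => inr c end))).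
  - rewrite (sat_rename p (fun i => i) _ _ (fun i => eq_refl)); tauto.
  - intro i; destruct (T i); reflexivity.
Qed.

(** The two formulas come with separate assignments. Moving the variables of one to even and of the
    other to odd indices lets one assignment serve both. *)
Lemma D_pair (P Q : (nat -> V) -> Prop) : D P -> D Q ->
  exists p q T, forall e, (P e <-> sat (fun i => value e (T i)) p) /\
                          (Q e <-> sat (fun i => value e (T i)) q).
Proof.
  intros (p & T & K) (q & T' & K').
  exists (rename (fun i => 2 * i) p), (rename (fun i => S (2 * i)) q).
  exists (fun i => if Nat.even i then T (Nat.div2 i) else T' (Nat.div2 i)).
  intro e; rewrite K, K'; split; symmetry; apply sat_rename; intro i.
  - rewrite Nat.even_mul, Nat.div2_double; reflexivity.
  - rewrite Nat.even_succ, Nat.odd_mul, Nat.div2_succ_double; reflexivity.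
Qed.

Lemma D_and (P Q : (nat -> V) -> Prop) : D P -> D Q -> D (fun e => P e /\ Q e).
Proof.
  intros HP HQ; destruct (D_pair P Q HP HQ) as (p & q & T & K).
  exists (Fand p q), T; intro e; simpl; destruct (K e); tauto.
Qed.

Lemma D_or (P Q : (nat -> V) -> Prop) : D P -> D Q -> D (fun e => P e \/ Q e).
Proof.
  intros HP HQ; destruct (D_pair P Q HP HQ) as (p & q & T & K).
  exists (For p q), T; intro e; simpl; destruct (K e); tauto.
Qed.

Lemma D_imp (P Q : (nat -> V) -> Prop) : D P -> D Q -> D (fun e => P e -> Q e).
Proof.
  intros HP HQ; destruct (D_pair P Q HP HQ) as (p & q & T & K).
  exists (Fimp p q), T; intro e; simpl; destruct (K e); tauto.
Qed.

Lemma D_not (P : (nat -> V) -> Prop) : D P -> D (fun e => ~ P e).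
Proof. intro H; apply (D_imp P _ H), D_const. Qed.

Lemma D_iff (P Q : (nat -> V) -> Prop) : D P -> D Q -> D (fun e => P e <-> Q e).
Proof. intros; apply D_and; apply D_imp; assumption. Qed.

Lemma D_all (Q : (nat -> V) -> V -> Prop) :
  D (fun e => Q (fun i => e (S i)) (e 0)) -> D (fun e => forall x, Q e x).
Proof.
  intros (p & T & K).
  (* Every variable that denotes entry 0 becomes the bound index 0. The others move up by one, and
     their assignment is lowered past the entry that is now bound. *)
  exists (Fall (rename (fun i => match T i with inl 0 => 0 | _ => S i end) p)),
    (fun i => match T i with inl j => inl (pred j) | inr c => inr c end).
  intro e; simpl.
  assert (L : forall x, Q e x <->
    sat (scons x (fun i => value e
        match T i with inl j => inl (pred j) | inr c => inr c end))
      (rename (fun i => match T i with inl 0 => 0 | _ => S i end) p)).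
  { intro x; specialize (K (scons x e)); simpl in K.
    change (Q e x <-> sat (fun i => value (scons x e) (T i)) p) in K.
    rewrite K; symmetry; apply sat_rename.
    intro i; destruct (T i) as [[|j]|c] eqn:E; simpl; rewrite ?E; reflexivity. }
  split; intros M x; apply L, M.
Qed.

Lemma D_ex (Q : (nat -> V) -> V -> Prop) :
  D (fun e => Q (fun i => e (S i)) (e 0)) -> D (fun e => exists x, Q e x).
Proof.
  intro H.
  apply (D_ext (fun e => ~ forall x, ~ Q e x)).
  - intro e; split.
    + intros [x K] L; exact (L x K).
    + intro K; apply not_all_not_ex in K; exact K.
  - apply D_not, (D_all (fun e x => ~ Q e x)), D_not, H.
Qed.

Lemma DT_rename (r : nat -> nat) (t : (nat -> V) -> V) :
  DT t -> DT (fun e => t (fun i => e (r i))).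
Proof. exact (D_rename (scons 0 (fun i => S (r i))) _). Qed.

Lemma DT_var (i : nat) : DT (fun e => e i).
Proof.
  exists (Feq 0 1), (fun k => match k with 0 => inl 0 | _ => inl (S i) end).
  simpl; tauto.
Qed.

Lemma DT_const (c : V) : DT (fun _ => c).
Proof.
  exists (Feq 0 1), (fun k => match k with 0 => inl 0 | _ => inr c end).
  simpl; tauto.
Qed.

(** Substitution becomes quantification: a bound variable names the value [t e] by means of its
    graph. *)
Lemma D_subst (Q : (nat -> V) -> V -> Prop) (t : (nat -> V) -> V) :
  D (fun e => Q (fun i => e (S i)) (e 0)) -> DT t -> D (fun e => Q e (t e)).
Proof.
  intros HQ Ht.
  apply (D_ext (fun e => exists x, x = t e /\ Q e x)).
  - intro e; split; [intro K; exists (t e); auto | intros (x & -> & K); exact K].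
  - apply (D_ex (fun e x => x = t e /\ Q e x)), D_and; assumption.
Qed.

Definition D1 (R : V -> Prop) := D (fun e => R (e 0)).
Definition D2 (R : V -> V -> Prop) := D (fun e => R (e 0) (e 1)).
Definition D3 (R : V -> V -> V -> Prop) := D (fun e => R (e 0) (e 1) (e 2)).
Definition F1 (F : V -> V) := DT (fun e => F (e 0)).
Definition F2 (F : V -> V -> V) := DT (fun e => F (e 0) (e 1)).
Definition F3 (F : V -> V -> V -> V) := DT (fun e => F (e 0) (e 1) (e 2)).

Lemma D1_app R t : D1 R -> DT t -> D (fun e => R (t e)).
Proof.
  intros HR Ht; apply (D_subst (fun _ x => R x) t); [exact HR | exact Ht].
Qed.

(** Arguments are substituted one at a time; each substitution pushes a variable onto the
    environment, which the renamings account for. *)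
Lemma D2_app R t u : D2 R -> DT t -> DT u -> D (fun e => R (t e) (u e)).
Proof.
  intros HR Ht Hu; apply (D_subst (fun e x => R x (u e)) t); [|exact Ht].
  apply (D_subst (fun e y => R (e 0) y)).
  - exact (D_rename (fun i => match i with 0 => 1 | S _ => 0 end) _ HR).
  - exact (DT_rename S u Hu).
Qed.

Lemma D3_app R t u v :
  D3 R -> DT t -> DT u -> DT v -> D (fun e => R (t e) (u e) (v e)).
Proof.
  intros HR Ht Hu Hv; apply (D_subst (fun e x => R x (u e) (v e)) t); [|exact Ht].
  apply (D_subst (fun e y => R (e 0) y (v (fun i => e (S i))))).
  - apply (D_subst (fun e z => R (e 1) (e 0) z)).
    + exact (D_rename (fun i => match i with 0 => 2 | 1 => 1 | _ => 0 end) _ HR).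
    + exact (DT_rename (fun i => S (S i)) v Hv).
  - exact (DT_rename S u Hu).
Qed.

Lemma D4_app R t u v w :
  D (fun e => R (e 0) (e 1) (e 2) (e 3)) -> DT t -> DT u -> DT v -> DT w ->
  D (fun e => R (t e) (u e) (v e) (w e)).
Proof.
  intros HR Ht Hu Hv Hw; apply (D_subst (fun e x => R x (u e) (v e) (w e)) t); [|exact Ht].
  apply (D_subst (fun e y => R (e 0) y (v (fun i => e (S i))) (w (fun i => e (S i))))).
  - apply (D_subst (fun e z => R (e 1) (e 0) z (w (fun i => e (S (S i)))))).
    + apply (D_subst (fun e z => R (e 2) (e 1) (e 0) z)).
      * exact (D_rename (fun i => match i with 0 => 3 | 1 => 2 | 2 => 1 | _ => 0 end) _ HR).
      * exact (DT_rename (fun i => S (S (S i))) w Hw).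
    + exact (DT_rename (fun i => S (S i)) v Hv).
  - exact (DT_rename S u Hu).
Qed.

Lemma F1_app F t : F1 F -> DT t -> DT (fun e => F (t e)).
Proof.
  intros HF Ht; apply (D2_app (fun y x => y = F x)); [exact HF | apply DT_var|].
  exact (DT_rename S t Ht).
Qed.

Lemma F2_app F t u : F2 F -> DT t -> DT u -> DT (fun e => F (t e) (u e)).
Proof.
  intros HF Ht Hu; apply (D3_app (fun y x x' => y = F x x')); [exact HF | apply DT_var| |].
  - exact (DT_rename S t Ht).
  - exact (DT_rename S u Hu).
Qed.

Lemma F3_app F t u v :
  F3 F -> DT t -> DT u -> DT v -> DT (fun e => F (t e) (u e) (v e)).
Proof.
  intros HF Ht Hu Hv.
  apply (D4_app (fun y x x' x'' => y = F x x' x'')); [exact HF | apply DT_var| | |].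
  - exact (DT_rename S t Ht).
  - exact (DT_rename S u Hu).
  - exact (DT_rename S v Hv).
Qed.

Lemma D_eq t u : DT t -> DT u -> D (fun e => t e = u e).
Proof.
  apply (D2_app (fun x y => x = y)).
  exists (Feq 0 1), (fun i => inl i); simpl; tauto.
Qed.

Lemma D_mem t u : DT t -> DT u -> D (fun e => t e ∈ u e).
Proof.
  apply (D2_app (fun x y => x ∈ y)).
  exists (Fmem 0 1), (fun i => inl i); simpl; tauto.
Qed.

Lemma DT_ite P t u : D P -> DT t -> DT u -> DT (fun e => ite (P e) (t e) (u e)).
Proof.
  intros HP Ht Hu.
  apply (D_ext (fun e => (P (fun i => e (S i)) /\ e 0 = t (fun i => e (S i))) \/
                         (~ P (fun i => e (S i)) /\ e 0 = u (fun i => e (S i))))).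
  - intro e; destruct (classic (P (fun i => e (S i)))) as [H|H];
      [rewrite ite_true by exact H | rewrite ite_false by exact H]; tauto.
  - apply D_or; apply D_and; try assumption.
    + exact (D_rename S P HP).
    + apply D_not; exact (D_rename S P HP).
Qed.

End Definability.

Create HintDb definable.

Section SetTheory.
Context {V : set_structure} (HZF : ZF V).

(** * Sets, pairs and functions *)

Lemma ex_empty : exists o : V, is_empty o.
Proof. destruct (ZF_infinity V HZF) as (I & (o & Ho & _) & _); eauto. Qed.

(** The description is used once, in the metatheory, and extensionality leaves a single candidate;
    the model gains no choice from it. *)
Definition emp : V := proj1_sig (constructive_indefinite_description _ ex_empty).

Lemma emp_spec (x : V) : ~ x ∈ emp.
Proof. exact (proj2_sig (constructive_indefinite_description _ ex_empty) x). Qed.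

(* Defaults to the empty set when there is no unique [y] satisfying [P]. *)
Definition the (P : V -> Prop) : V :=
  match excluded_middle_informative (exists! y, P y) with
  | left h => proj1_sig (constructive_definite_description P h)
  | right _ => emp
  end.

Lemma the_spec (P : V -> Prop) :
  (exists y, P y) -> (forall y z, P y -> P z -> y = z) -> P (the P).
Proof.
  intros [y Hy] U; unfold the; destruct excluded_middle_informative as [h|h].
  - apply proj2_sig.
  - exfalso; apply h; exists y; split; auto.
Qed.

Lemma the_eq (P : V -> Prop) y : P y -> (forall z, P z -> z = y) -> the P = y.
Proof.
  intros Hy U; apply U, the_spec; [eauto|].
  intros a b Ha Hb; rewrite (U a Ha), (U b Hb); reflexivity.
Qed.

Lemma the_none (P : V -> Prop) : (forall y, ~ P y) -> the P = emp.
Proof.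
  intros H; unfold the; destruct excluded_middle_informative as [h|h].
  - exfalso; destruct h as (y & h & _); exact (H y h).
  - reflexivity.
Qed.

(** Both cases of [the] are first-order: unique existence holds and the value is the witness, or it
    fails and the value is [emp]. *)
Lemma DT_the (Q : (nat -> V) -> V -> Prop) :
  D (fun e => Q (fun i => e (S i)) (e 0)) -> DT (fun e => the (Q e)).
Proof.
  intro H.
  apply (D_ext (fun e =>
    ((exists y, Q (fun i => e (S i)) y /\ forall z, Q (fun i => e (S i)) z -> y = z) /\
     Q (fun i => e (S i)) (e 0)) \/
    (~ (exists y, Q (fun i => e (S i)) y /\ forall z, Q (fun i => e (S i)) z -> y = z) /\
     e 0 = emp))).
  - intro e; set (P := Q (fun i => e (S i))).
    change (e 0 = the P <-> ((exists! y, P y) /\ P (e 0)) \/ (~ (exists! y, P y) /\ e 0 = emp)).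
    unfold the; destruct excluded_middle_informative as [h|h]; [|tauto].
    destruct constructive_definite_description as [y Hy]; simpl.
    split.
    + intros ->; auto.
    + intros [[(z & Hz & U) K]|[K _]]; [|tauto].
      rewrite <- (U _ Hy), <- (U _ K); reflexivity.
  - assert (H' : D (fun e => Q (fun i => e (S (S i))) (e 0)))
      by exact (D_rename (fun i => match i with 0 => 0 | S i => S (S i) end) _ H).
    assert (K : D (fun e => exists y, Q (fun i => e (S i)) y /\
                              forall z, Q (fun i => e (S i)) z -> y = z)).
    { apply (D_ex (fun e y => Q (fun i => e (S i)) y /\
                     forall z, Q (fun i => e (S i)) z -> y = z)), D_and; [exact H'|].
      apply (D_all (fun e z => Q (fun i => e (S (S i))) z -> e 0 = z)), D_imp.
      - exact (D_rename (fun i => match i with 0 => 0 | S i => S (S (S i)) end) _ H).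
      - apply D_eq; apply DT_var. }
    apply D_or; apply D_and; [exact K | exact H | apply D_not, K |].
    apply D_eq; [apply DT_var | apply DT_const].
Qed.

(** Proves definability by recursion on the syntax. Subterms free of the environment become
    parameters; heads without a rule of their own are looked up in the database [definable]. *)
Ltac def :=
  cbv beta;
  match goal with
  | |- D1 _ => unfold D1; def
  | |- D2 _ => unfold D2; def
  | |- D3 _ => unfold D3; def
  | |- F1 _ => unfold F1; def
  | |- F2 _ => unfold F2; def
  | |- F3 _ => unfold F3; def
  | |- D (fun _ => ?P) => apply D_const
  | |- D (fun e => @?P e /\ @?Q e) => apply (D_and P Q); def
  | |- D (fun e => @?P e \/ @?Q e) => apply (D_or P Q); def
  | |- D (fun e => @?P e <-> @?Q e) => apply (D_iff P Q); def
  | |- D (fun e => ~ @?P e) => apply (D_not P); def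
  | |- D (fun e => exists x, @?Q e x) => apply (D_ex Q); def
  | |- D (fun e => @?t e = @?u e) => apply (D_eq t u); def
  | |- D (fun e => @?t e ∈ @?u e) => apply (D_mem t u); def
  | |- D (fun e => forall x : carrier _, @?Q e x) => apply (D_all Q); def
  | |- D (fun e => @?P e -> @?Q e) => apply (D_imp P Q); def
  | |- D (fun e => ?R (@?t e) (@?u e) (@?v e)) =>
      apply (D3_app R t u v); [solve [auto with definable] | def ..]
  | |- D (fun e => ?R (@?t e) (@?u e)) =>
      apply (D2_app R t u); [solve [auto with definable] | def ..]
  | |- D (fun e => ?R (@?t e)) =>
      apply (D1_app R t); [solve [auto with definable] | def ..]
  | |- DT (fun _ => ?c) => apply DT_const
  | |- DT (fun e => e ?i) => apply (DT_var i)
  | |- DT (fun e => the (@?Q e)) => apply (DT_the Q); def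
  | |- DT (fun e => ite (@?P e) (@?t e) (@?u e)) => apply (DT_ite P t u); def
  | |- DT (fun e => ?F (@?t e) (@?u e) (@?v e)) =>
      apply (F3_app F t u v); [solve [auto with definable] | def ..]
  | |- DT (fun e => ?F (@?t e) (@?u e)) =>
      apply (F2_app F t u); [solve [auto with definable] | def ..]
  | |- DT (fun e => ?F (@?t e)) =>
      apply (F1_app F t); [solve [auto with definable] | def ..]
  end.

Lemma ext (a b : V) : (forall x, x ∈ a <-> x ∈ b) -> a = b.
Proof. apply (ZF_extensionality V HZF). Qed.

Lemma the_set (P : V -> Prop) :
  (exists b : V, forall x, x ∈ b <-> P x) ->
  forall x, x ∈ the (fun b => forall x, x ∈ b <-> P x) <-> P x.
Proof.
  intro H; apply (the_spec (fun b => forall x, x ∈ b <-> P x) H).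
  intros y z Hy Hz; apply ext; intro x; rewrite Hy, Hz; tauto.
Qed.

Lemma mem_irrefl (x : V) : ~ x ∈ x.
Proof.
  intro H; destruct (ZF_pairing V HZF x x) as [c Hc].
  destruct (ZF_foundation V HZF c) as (y & Hy & K).
  - exists x; apply Hc; auto.
  - apply Hc in Hy; assert (y = x) by tauto; subst y.
    apply (K x H), Hc; auto.
Qed.

Lemma mem_asym (x y : V) : x ∈ y -> ~ y ∈ x.
Proof.
  intros H H'; destruct (ZF_pairing V HZF x y) as [c Hc].
  destruct (ZF_foundation V HZF c) as (z & Hz & K).
  - exists x; apply Hc; auto.
  - apply Hc in Hz; destruct Hz as [->| ->].
    + apply (K y H'), Hc; auto.
    + apply (K x H), Hc; auto.
Qed.

(** * Separation and replacement for definable predicates *)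

Definition sep (a : V) (P : V -> Prop) : V :=
  the (fun b => forall x, x ∈ b <-> x ∈ a /\ P x).

Lemma sep_spec (a : V) (P : V -> Prop) (HP : D1 P) (x : V) :
  x ∈ sep a P <-> x ∈ a /\ P x.
Proof.
  apply (the_set (fun x => x ∈ a /\ P x)).
  destruct HP as (p & T & K).
  (* Index 0 keeps the element to be tested. Parameters move into the environment, and variables for
     other entries receive the arbitrary value [a]. *)
  destruct (ZF_separation V HZF
    (rename (fun i => match T i with inl 0 => 0 | _ => S i end) p)
    (fun i => match T i with inl j => a | inr c => c end) a) as [b Hb].
  exists b; intro y; rewrite Hb; apply and_iff_compat_l.
  rewrite (K (scons y (fun _ => a))).
  apply sat_rename; intro i; destruct (T i) as [[|j]|c] eqn:E; simpl; rewrite ?E; reflexivity.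
Qed.

Lemma replacement (a : V) (F : V -> V) (HF : F1 F) :
  exists b, forall y, y ∈ b <-> exists x, x ∈ a /\ y = F x.
Proof.
  (* [F1] has the value at index 0 and the argument at index 1; the replacement axiom has them the
     other way round. *)
  assert (H : D (fun e => e 1 = F (e 0)))
    by exact (D_rename (fun i => match i with 0 => 1 | _ => 0 end) _ HF).
  destruct H as (p & T & K).
  set (q := rename (fun i => match T i with inl 0 => 0 | inl 1 => 1 | _ => S (S i) end) p).
  set (e := fun i => match T i with inl j => a | inr c => c end).
  assert (L : forall x y, sat (scons x (scons y e)) q <-> y = F x).
  { intros x y; rewrite (K (scons x (scons y (fun _ => a)))).
    apply sat_rename; intro i; destruct (T i) as [[|[|j]]|c] eqn:E; simpl;
      unfold e; rewrite ?E; reflexivity. }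
  destruct (ZF_replacement V HZF q e a) as [b Hb].
  - intros x y y' _ H H'; apply L in H, H'; congruence.
  - exists b; intro y; rewrite Hb; split; intros (x & Hx & Hy); exists x; split; auto;
      apply L; exact Hy.
Qed.

Definition upair (a b : V) : V := the (fun c => forall x, x ∈ c <-> x = a \/ x = b).
Definition op (a b : V) : V := upair (upair a a) (upair a b).
Definition adj (a b : V) : V := the (fun c => forall x, x ∈ c <-> x ∈ a \/ x = b).
Definition pow (a : V) : V := the (fun b => forall x, x ∈ b <-> (forall y, y ∈ x -> y ∈ a)).
Definition sc (a : V) : V := adj a a.
Definition lam (X : V) (F : V -> V) : V :=
  the (fun f => forall p, p ∈ f <-> exists x, x ∈ X /\ p = op x (F x)).

Lemma upair_spec a b x : x ∈ upair a b <-> x = a \/ x = b.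
Proof. apply (the_set (fun x => x = a \/ x = b)), (ZF_pairing V HZF). Qed.

Lemma F2_upair : F2 upair.
Proof. unfold upair; def. Qed.
Hint Resolve F2_upair : definable.

Lemma F2_op : F2 op.
Proof. unfold op; def. Qed.
Hint Resolve F2_op : definable.

Lemma adj_spec a b x : x ∈ adj a b <-> x ∈ a \/ x = b.
Proof.
  apply (the_set (fun x => x ∈ a \/ x = b)).
  destruct (ZF_union V HZF (upair a (upair b b))) as [c Hc].
  exists c; intro y; rewrite Hc; split.
  - intros (z & Hy & Hz); apply upair_spec in Hz; destruct Hz as [->| ->]; auto.
    apply upair_spec in Hy; tauto.
  - intros [H| ->].
    + exists a; rewrite upair_spec; auto.
    + exists (upair b b); rewrite !upair_spec; auto.
Qed.

Lemma F2_adj : F2 adj.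
Proof. unfold adj; def. Qed.
Hint Resolve F2_adj : definable.

Lemma F1_sc : F1 sc.
Proof. unfold sc; def. Qed.
Hint Resolve F1_sc : definable.

Lemma pow_spec a x : x ∈ pow a <-> (forall y, y ∈ x -> y ∈ a).
Proof. apply (the_set (fun x => forall y, y ∈ x -> y ∈ a)), (ZF_power V HZF). Qed.

Lemma upair_inj a b c d : upair a b = upair c d -> (a = c /\ b = d) \/ (a = d /\ b = c).
Proof.
  intro H.
  assert (K : forall x, (x = a \/ x = b) <-> (x = c \/ x = d))
    by (intro x; rewrite <- !upair_spec, H; tauto).
  pose proof (proj1 (K a) (or_introl eq_refl)); pose proof (proj1 (K b) (or_intror eq_refl)).
  pose proof (proj2 (K c) (or_introl eq_refl)); pose proof (proj2 (K d) (or_intror eq_refl)).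
  intuition congruence.
Qed.

Lemma op_inj a b c d : op a b = op c d -> a = c /\ b = d.
Proof.
  intro H; apply upair_inj in H; destruct H as [[H H']|[H H']];
    apply upair_inj in H, H'; intuition congruence.
Qed.

Lemma is_upair_iff a b p : is_upair a b p <-> p = upair a b.
Proof.
  split.
  - intro H; apply ext; intro x; rewrite upair_spec; apply H.
  - intros -> x; apply upair_spec.
Qed.

Lemma is_opair_iff a b p : is_opair a b p <-> p = op a b.
Proof.
  unfold is_opair; split.
  - intros (u & v & H & H' & K); apply is_upair_iff in H, H', K; subst; reflexivity.
  - intros ->; exists (upair a a), (upair a b); rewrite !is_upair_iff; auto.
Qed.

Lemma maps_iff (f x y : V) : maps f x y <-> op x y ∈ f.
Proof.
  unfold maps; split.
  - intros (p & H & K); apply is_opair_iff in H; subst; exact K.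
  - intro H; exists (op x y); rewrite is_opair_iff; auto.
Qed.

Lemma is_succ_iff (x y : V) : is_succ x y <-> y = sc x.
Proof.
  split.
  - intro H; apply ext; intro z; unfold sc; rewrite adj_spec; apply H.
  - intros -> z; apply adj_spec.
Qed.

Lemma sc_spec (x y : V) : y ∈ sc x <-> y ∈ x \/ y = x.
Proof. apply adj_spec. Qed.

Lemma D3_maps : D3 (@maps V).
Proof. unfold maps, is_opair, is_upair; def. Qed.
Hint Resolve D3_maps : definable.

Lemma lam_spec (X : V) (F : V -> V) (HF : F1 F) (x y : V) :
  maps (lam X F) x y <-> x ∈ X /\ y = F x.
Proof.
  rewrite maps_iff; unfold lam.
  rewrite (the_set (fun p => exists x, x ∈ X /\ p = op x (F x))).
  - split.
    + intros (z & Hz & K); apply op_inj in K; destruct K as [-> ->]; auto.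
    + intros [Hx ->]; eauto.
  - apply (replacement X (fun x => op x (F x))); def.
Qed.

Lemma mem_lam (X : V) (F : V -> V) (HF : F1 F) (p : V) :
  p ∈ lam X F <-> exists x, x ∈ X /\ p = op x (F x).
Proof.
  apply (the_set (fun p => exists x, x ∈ X /\ p = op x (F x))).
  apply (replacement X (fun x => op x (F x))); def.
Qed.

(** Total application: outside the domain of [f] the value is [emp]. *)
Definition app (f x : V) : V := the (maps f x).

Lemma F2_app_set : F2 app.
Proof. unfold app; apply DT_the; def. Qed.
Hint Resolve F2_app_set : definable.

Lemma app_eq (f x y : V) :
  (forall x y y', maps f x y -> maps f x y' -> y = y') -> maps f x y -> app f x = y.
Proof. intros U H; apply the_eq; [exact H | intros z Hz; eapply U; eauto]. Qed.

Lemma app_lam (X : V) (F : V -> V) (HF : F1 F) (x : V) :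
  x ∈ X -> app (lam X F) x = F x.
Proof.
  intro H; apply app_eq.
  - intros a b c K L; apply lam_spec in K, L; auto; destruct K, L; congruence.
  - apply lam_spec; auto.
Qed.

Lemma maps_app (f X Y x y : V) : is_function f X Y ->
  (maps f x y <-> x ∈ X /\ y = app f x).
Proof.
  intros (H & T & U); split.
  - intro K; split; [|symmetry; apply app_eq; auto].
    apply maps_iff in K; destruct (H _ K) as (a & b & Ha & _ & L).
    apply is_opair_iff, op_inj in L; destruct L as [-> _]; exact Ha.
  - intros [Hx ->]; destruct (T x Hx) as [y Hy]; rewrite (app_eq f x y); auto.
Qed.

Lemma app_mem (f X Y x : V) : is_function f X Y -> x ∈ X -> app f x ∈ Y.
Proof.
  intros Hf Hx; assert (K : maps f x (app f x)) by (apply (maps_app f X Y); auto).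
  apply maps_iff in K; destruct Hf as (H & _); destruct (H _ K) as (a & b & _ & Hb & L).
  apply is_opair_iff, op_inj in L; destruct L as [_ ->]; exact Hb.
Qed.

Lemma function_ext (f g X Y : V) : is_function f X Y -> is_function g X Y ->
  (forall x, x ∈ X -> app f x = app g x) -> f = g.
Proof.
  assert (L : forall f g, is_function f X Y -> is_function g X Y ->
    (forall x, x ∈ X -> app f x = app g x) -> forall p, p ∈ f -> p ∈ g).
  { clear f g; intros f g Hf Hg E p Hp.
    destruct (proj1 Hf p Hp) as (x & y & Hx & _ & K); apply is_opair_iff in K; subst p.
    apply maps_iff in Hp; apply (maps_app f X Y) in Hp; [|exact Hf].
    apply maps_iff, (maps_app g X Y); [exact Hg|].
    destruct Hp as [_ ->]; auto. }
  intros Hf Hg E; apply ext; intro p; split; apply L; auto.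
  intros x Hx; symmetry; auto.
Qed.

Lemma lam_function (X Y : V) (F : V -> V) (HF : F1 F) :
  (forall x, x ∈ X -> F x ∈ Y) -> is_function (lam X F) X Y.
Proof.
  intro H; split; [|split].
  - intros p Hp; apply mem_lam in Hp; auto; destruct Hp as (x & Hx & ->).
    exists x, (F x); rewrite is_opair_iff; auto.
  - intros x Hx; exists (F x); apply lam_spec; auto.
  - intros x y y' K L; apply lam_spec in K, L; auto; destruct K, L; congruence.
Qed.

Lemma lam_injection (X Y : V) (F : V -> V) (HF : F1 F) :
  (forall x, x ∈ X -> F x ∈ Y) ->
  (forall x x', x ∈ X -> x' ∈ X -> F x = F x' -> x = x') ->
  is_injection (lam X F) X Y.
Proof.
  intros H K; split; [apply lam_function; auto|].
  intros x x' y L M; apply lam_spec in L, M; auto.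
  destruct L as [? ->], M; apply K; auto.
Qed.

Lemma lam_bijection (X Y : V) (F : V -> V) (HF : F1 F) :
  (forall x, x ∈ X -> F x ∈ Y) ->
  (forall x x', x ∈ X -> x' ∈ X -> F x = F x' -> x = x') ->
  (forall y, y ∈ Y -> exists x, x ∈ X /\ F x = y) ->
  is_bijection (lam X F) X Y.
Proof.
  intros H K L; split; [apply lam_injection; auto|].
  intros y Hy; destruct (L y Hy) as (x & Hx & <-); exists x; apply lam_spec; auto.
Qed.

Lemma app_inj (f X Y x x' : V) : is_injection f X Y ->
  x ∈ X -> x' ∈ X -> app f x = app f x' -> x = x'.
Proof.
  intros [Hf U] Hx Hx' E; apply (U x x' (app f x)); apply (maps_app f X Y); auto.
Qed.

Lemma app_surj (f X Y y : V) : is_bijection f X Y ->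
  y ∈ Y -> exists x, x ∈ X /\ app f x = y.
Proof.
  intros [[Hf _] S] Hy; destruct (S y Hy) as [x Hx].
  apply (maps_app f X Y) in Hx; auto; destruct Hx as [Hx ->]; eauto.
Qed.

Lemma injection_comp (f g X Y Z : V) : is_injection f X Y -> is_injection g Y Z ->
  exists h, is_injection h X Z.
Proof.
  intros Hf Hg; exists (lam X (fun x => app g (app f x))); apply lam_injection.
  - def.
  - intros x Hx; apply (app_mem g Y Z); [apply Hg|]; apply (app_mem f X Y); [apply Hf|auto].
  - intros x x' Hx Hx' E; apply (app_inj f X Y); auto.
    apply (app_inj g Y Z); auto; apply (app_mem f X Y); auto; apply Hf.
Qed.

(** Preimages are unique, so the inverse is given by description, without choice. *)
Lemma bijection_inv (f X Y : V) : is_bijection f X Y -> exists g, is_bijection g Y X.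
Proof.
  intro Hf.
  assert (L : forall x, x ∈ X -> the (fun z => z ∈ X /\ app f z = app f x) = x).
  { intros x Hx; apply the_eq; auto.
    intros z [Hz E]; apply (app_inj f X Y); auto; apply Hf. }
  assert (Lf : is_function f X Y) by apply Hf.
  exists (lam Y (fun y => the (fun z => z ∈ X /\ app f z = y))); apply lam_bijection.
  - def.
  - intros y Hy; destruct (app_surj f X Y y Hf Hy) as (x & Hx & <-); rewrite L; auto.
  - intros y y' Hy Hy' E; destruct (app_surj f X Y y Hf Hy) as (x & Hx & <-).
    destruct (app_surj f X Y y' Hf Hy') as (x' & Hx' & <-); rewrite !L in E; congruence.
  - intros x Hx; exists (app f x); split; auto; apply (app_mem f X Y); auto.
Qed.

Lemma equinumerous_sym (X Y : V) : equinumerous X Y -> equinumerous Y X.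
Proof. intros [f Hf]; apply (bijection_inv f X Y Hf). Qed.

Lemma D3_is_bijection : D3 (@is_bijection V).
Proof. unfold is_bijection, is_injection, is_function, is_opair, is_upair; def. Qed.
Hint Resolve D3_is_bijection : definable.

Lemma D3_is_injection : D3 (@is_injection V).
Proof. unfold is_injection, is_function, is_opair, is_upair; def. Qed.
Hint Resolve D3_is_injection : definable.

Lemma D2_equinumerous : D2 (@equinumerous V).
Proof. unfold equinumerous; def. Qed.
Hint Resolve D2_equinumerous : definable.

(** * Natural numbers *)

Lemma D1_is_natural : D1 (@is_natural V).
Proof. unfold is_natural, inductive, is_empty, is_succ; def. Qed.
Hint Resolve D1_is_natural : definable.

Lemma is_empty_iff (x : V) : is_empty x <-> x = emp.
Proof.
  split.
  - intro H; apply ext; intro z; split; intro K; [destruct (H z K)|destruct (emp_spec z K)].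
  - intros ->; exact emp_spec.
Qed.

Lemma inductive_iff (I : V) :
  inductive I <-> emp ∈ I /\ (forall x, x ∈ I -> sc x ∈ I).
Proof.
  unfold inductive; split; intros [H K]; split.
  - destruct H as (o & Ho & H); apply is_empty_iff in Ho; subst; exact H.
  - intros x Hx; destruct (K x Hx) as (y & Hy & L); apply is_succ_iff in Hy; subst; exact L.
  - exists emp; rewrite is_empty_iff; auto.
  - intros x Hx; exists (sc x); rewrite is_succ_iff; auto.
Qed.

Lemma nat_emp : is_natural emp.
Proof. intros I HI; apply inductive_iff in HI; apply HI. Qed.

Lemma nat_sc (n : V) : is_natural n -> is_natural (sc n).
Proof.
  intros H I HI; pose proof (H I HI) as K; apply inductive_iff in HI; apply HI, K.
Qed.
Hint Resolve nat_emp nat_sc : core.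

(** The naturals with [P], separated from some inductive set, form an inductive set again and so
    contain every natural, nonstandard ones included. *)
Lemma nat_induction (P : V -> Prop) (HP : D1 P) :
  P emp -> (forall x, is_natural x -> P x -> P (sc x)) -> forall n, is_natural n -> P n.
Proof.
  intros H0 HS n Hn; destruct (ZF_infinity V HZF) as [I HI].
  assert (DP : D1 (fun x => is_natural x /\ P x)) by def.
  assert (K : n ∈ sep I (fun x => is_natural x /\ P x)).
  { apply Hn, inductive_iff; apply inductive_iff in HI; destruct HI as [I0 IS]; split.
    - apply sep_spec; auto.
    - intros x Hx; apply sep_spec in Hx; auto; destruct Hx as (Hx & Nx & Px).
      apply sep_spec; auto. }
  apply sep_spec in K; tauto.
Qed.

Lemma nat_trans (n x y : V) : is_natural n -> x ∈ n -> y ∈ x -> y ∈ n.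
Proof.
  intro Hn; revert n Hn x y.
  apply (nat_induction (fun n => forall x y, x ∈ n -> y ∈ x -> y ∈ n)).
  - def.
  - intros x y H; destruct (emp_spec _ H).
  - intros n Hn IH x y Hx Hy; apply sc_spec; apply sc_spec in Hx; destruct Hx as [Hx| ->]; eauto.
Qed.

Lemma nat_mem (n x : V) : is_natural n -> x ∈ n -> is_natural x.
Proof.
  intro Hn; revert n Hn x; apply (nat_induction (fun n => forall x, x ∈ n -> is_natural x)).
  - def.
  - intros x H; destruct (emp_spec _ H).
  - intros n Hn IH x Hx; apply sc_spec in Hx; destruct Hx as [Hx| ->]; auto.
Qed.

Lemma nat_cases (n : V) : is_natural n -> n = emp \/ exists m, is_natural m /\ n = sc m.
Proof.
  revert n; apply (nat_induction (fun n => n = emp \/ exists m, is_natural m /\ n = sc m)).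
  - def.
  - auto.
  - intros n Hn _; eauto.
Qed.

Lemma mem_sc_self (n : V) : n ∈ sc n.
Proof. apply sc_spec; auto. Qed.
Hint Resolve mem_sc_self : core.

Lemma mem_sc (n x : V) : x ∈ n -> x ∈ sc n.
Proof. intro; apply sc_spec; auto. Qed.
Hint Resolve mem_sc : core.

Lemma sc_mem_sc (b a : V) : is_natural b -> a ∈ b -> sc a ∈ sc b.
Proof.
  intro Hb; revert b Hb a; apply (nat_induction (fun b => forall a, a ∈ b -> sc a ∈ sc b)).
  - def.
  - intros x H; destruct (emp_spec _ H).
  - intros b Hb IH a Ha; apply sc_spec in Ha; destruct Ha as [Ha| ->]; auto.
Qed.

Lemma sc_mem_inv (b a : V) : is_natural b -> sc a ∈ sc b -> a ∈ b.
Proof.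
  intros Hb H; apply sc_spec in H; destruct H as [H|H].
  - eapply nat_trans; eauto.
  - rewrite <- H; auto.
Qed.

Lemma sc_inj (a b : V) : sc a = sc b -> a = b.
Proof.
  intro H; assert (Ha : a ∈ sc b) by (rewrite <- H; auto).
  assert (Hb : b ∈ sc a) by (rewrite H; auto).
  apply sc_spec in Ha, Hb; destruct Ha as [Ha|Ha], Hb as [Hb|Hb]; auto.
  destruct (mem_asym _ _ Ha Hb).
Qed.

Lemma sc_neq_emp (a : V) : sc a <> emp.
Proof. intro H; apply (emp_spec a); rewrite <- H; auto. Qed.

Lemma nat_trichotomy (a b : V) : is_natural a -> is_natural b -> a ∈ b \/ a = b \/ b ∈ a.
Proof.
  intros Ha Hb; revert a Ha; apply (nat_induction (fun a => a ∈ b \/ a = b \/ b ∈ a)).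
  - def.
  - revert b Hb; apply (nat_induction (fun b => emp ∈ b \/ emp = b \/ b ∈ emp)).
    + def.
    + auto.
    + intros b Hb [H|[<-|H]]; auto; destruct (emp_spec _ H).
  - intros a Ha [H|[->|H]]; auto.
    apply (sc_mem_sc b) in H; auto; apply sc_spec in H; tauto.
Qed.

(** Here and below [j ∈ sc i] renders j ≤ i. In the induction step the maximum is [N] itself if it
    satisfies [P], and the earlier maximum otherwise. *)
Lemma nat_max (N : V) (P : V -> Prop) (HP : D1 P) : is_natural N ->
  (exists i, i ∈ N /\ P i) ->
  exists i, i ∈ N /\ P i /\ forall j, j ∈ N -> P j -> j ∈ sc i.
Proof.
  revert N; apply (nat_induction (fun N => (exists i, i ∈ N /\ P i) ->
    exists i, i ∈ N /\ P i /\ forall j, j ∈ N -> P j -> j ∈ sc i)).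
  - def.
  - intros (i & H & _); destruct (emp_spec _ H).
  - intros N HN IH (i & Hi & Pi).
    destruct (classic (P N)) as [H|H]; [exists N; auto|].
    destruct IH as (m & Hm & Pm & K).
    + exists i; split; auto; apply sc_spec in Hi; destruct Hi as [Hi| ->]; tauto.
    + exists m; repeat split; auto; intros j Hj Pj.
      apply sc_spec in Hj; destruct Hj as [Hj| ->]; [auto|tauto].
Qed.

(** * Definition by recursion on the internal naturals *)

Section Recursion.
Context (X0 : V -> V) (G : V -> V -> V -> V) (HX : F1 X0) (HG : F3 G).

(** The domain of [h] may reach beyond j, so that an approximation for j also serves every smaller
    natural. *)
Definition approx (p h j : V) : Prop :=
  (forall i y y', maps h i y -> maps h i y' -> y = y') /\ maps h emp (X0 p) /\
  forall i, i ∈ j -> exists y, maps h i y /\ maps h (sc i) (G p i y).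

(* The value at [j] of the function with [f 0 = X0 p] and [f (i+1) = G p i (f i)]. *)
Definition rec (p j : V) : V := the (fun y => exists h, approx p h j /\ maps h j y).

Lemma D3_approx : D3 approx.
Proof. unfold approx; def. Qed.
Hint Resolve D3_approx : definable.

Lemma F2_rec : F2 rec.
Proof. unfold rec; def. Qed.

Lemma approx_unique (p j h h' : V) : is_natural j -> approx p h j -> approx p h' j ->
  forall i, is_natural i -> i ∈ sc j -> forall y y', maps h i y -> maps h' i y' -> y = y'.
Proof.
  intros Hj (U & Z & R) (U' & Z' & R').
  apply (nat_induction (fun i => i ∈ sc j -> forall y y', maps h i y -> maps h' i y' -> y = y')).
  - def.
  - intros _ y y' Hy Hy'; rewrite (U _ _ _ Hy Z), (U' _ _ _ Hy' Z'); reflexivity.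
  - intros i Hi IH H y y' Hy Hy'; apply sc_mem_inv in H; auto.
    destruct (R i H) as (z & Hz & K), (R' i H) as (z' & Hz' & K').
    rewrite (U _ _ _ Hy K), (U' _ _ _ Hy' K'), (IH (mem_sc _ _ H) z z' Hz Hz'); reflexivity.
Qed.

Lemma approx_exists (p j : V) : is_natural j -> exists y h, approx p h j /\ maps h j y.
Proof.
  revert j; apply (nat_induction (fun j => exists y h, approx p h j /\ maps h j y)).
  - def.
  - exists (X0 p), (lam (sc emp) (fun _ => X0 p)).
    assert (L : F1 (fun _ => X0 p)) by def.
    repeat split.
    + intros i y y' H H'; apply lam_spec in H, H'; auto; destruct H, H'; congruence.
    + apply lam_spec; auto.
    + intros i H; destruct (emp_spec _ H).
    + apply lam_spec; auto.
  - intros j Hj (y & h & (U & Z & R) & H).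
    (* The old approximation is cut down to arguments up to j and receives the next value at j+1. *)
    set (F := fun i => ite (i = sc j) (G p j y) (app h i)).
    assert (L : F1 F) by (unfold F; def).
    assert (K : forall i z, i ∈ sc j -> maps h i z -> maps (lam (sc (sc j)) F) i z).
    { intros i z Hi Hz; apply lam_spec; auto; split; auto; unfold F; rewrite ite_false.
      - symmetry; apply app_eq; auto.
      - intros ->; exact (mem_irrefl _ Hi). }
    assert (M : maps (lam (sc (sc j)) F) (sc j) (G p j y)).
    { apply lam_spec; auto; split; auto; unfold F; rewrite ite_true; auto. }
    exists (G p j y), (lam (sc (sc j)) F); split; auto.
    repeat split.
    + intros i z z' I I'; apply lam_spec in I, I'; auto; destruct I, I'; congruence.
    + apply K; auto; destruct (nat_cases j Hj) as [->|(m & Hm & ->)]; auto.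
      destruct (nat_trichotomy emp (sc (sc m))) as [?|[E|E]]; auto.
      * destruct (sc_neq_emp _ (eq_sym E)).
      * destruct (emp_spec _ E).
    + intros i Hi; apply sc_spec in Hi; destruct Hi as [Hi| ->].
      * destruct (R i Hi) as (z & Hz & I); exists z; split; apply K; auto.
        apply sc_mem_sc; auto.
      * exists y; auto.
Qed.

Lemma rec_spec (p j : V) : is_natural j -> exists h, approx p h j /\ maps h j (rec p j).
Proof.
  intro Hj; apply (the_spec (fun y => exists h, approx p h j /\ maps h j y)).
  - apply approx_exists; auto.
  - intros y z (h & Hh & Hy) (h' & Hh' & Hz); eapply (approx_unique p j h h'); eauto.
Qed.

Lemma rec_emp (p : V) : rec p emp = X0 p.
Proof.
  destruct (rec_spec p emp) as (h & (U & Z & _) & H); auto; exact (U _ _ _ H Z).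
Qed.

(** An approximation for j+1 is one for j too, so by uniqueness its value at j is [rec p j]. *)
Lemma rec_sc (p j : V) : is_natural j -> rec p (sc j) = G p j (rec p j).
Proof.
  intro Hj; destruct (rec_spec p (sc j)) as (h & (U & Z & R) & H); auto.
  destruct (R j) as (y & Hy & K); auto.
  rewrite (U _ _ _ H K); f_equal.
  destruct (rec_spec p j) as (h' & Hh' & H'); auto.
  apply (approx_unique p j h h') with (i := j); auto.
  repeat split; auto.
Qed.

End Recursion.

(** Truncated at zero by the default of [the]: a closing bracket with nothing pending leaves the
    height at zero. *)
Definition prd (n : V) : V := the (fun m => n = sc m).

Lemma F1_prd : F1 prd.
Proof. unfold prd; def. Qed.
Hint Resolve F1_prd : definable.

Lemma prd_sc (n : V) : prd (sc n) = n.
Proof. apply the_eq; auto; intros z H; symmetry; apply sc_inj, H. Qed.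

Lemma prd_emp : prd emp = emp.
Proof. apply the_none; intros y H; exact (sc_neq_emp y (eq_sym H)). Qed.

Definition add (a b : V) : V := rec (fun a => a) (fun _ _ y => sc y) a b.

Lemma F2_add : F2 add.
Proof. apply (F2_rec (fun a => a) (fun _ _ y => sc y)); def. Qed.
Hint Resolve F2_add : definable.

Lemma add_emp (a : V) : add a emp = a.
Proof. apply rec_emp; def. Qed.

Lemma add_sc (a b : V) : is_natural b -> add a (sc b) = sc (add a b).
Proof. apply rec_sc; def. Qed.

Lemma sc_add (a b : V) : is_natural b -> add (sc a) b = sc (add a b).
Proof.
  revert b; apply (nat_induction (fun b => add (sc a) b = sc (add a b))).
  - def.
  - rewrite !add_emp; reflexivity.
  - intros b Hb IH; rewrite !add_sc, IH; auto.
Qed.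

Lemma nat_add (a b : V) : is_natural a -> is_natural b -> is_natural (add a b).
Proof.
  intro Ha; revert b; apply (nat_induction (fun b => is_natural (add a b))).
  - def.
  - rewrite add_emp; auto.
  - intros b Hb IH; rewrite add_sc; auto.
Qed.
Hint Resolve nat_add : core.

Lemma le_add (a b : V) : is_natural b -> a ∈ sc (add a b).
Proof.
  revert b; apply (nat_induction (fun b => a ∈ sc (add a b))).
  - def.
  - rewrite add_emp; auto.
  - intros b Hb IH; rewrite add_sc; auto.
Qed.

Lemma double_lt (b a : V) : is_natural b -> a ∈ b -> add a a ∈ add b b.
Proof.
  intro Hb; revert b Hb a; apply (nat_induction (fun b => forall a, a ∈ b -> add a a ∈ add b b)).
  - def.
  - intros a H; destruct (emp_spec _ H).
  - intros b Hb IH a Ha; rewrite add_sc, sc_add by auto.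
    apply sc_spec in Ha; destruct Ha as [Ha| ->]; auto.
Qed.

(** * Finite cardinalities *)

Lemma equinumerous_emp : equinumerous emp emp.
Proof.
  exists (lam emp (fun x => x)); apply lam_bijection; [def| | |];
    intros y; intros; exfalso; eapply emp_spec; eauto.
Qed.

Lemma equinumerous_adj (X d y : V) :
  equinumerous X d -> ~ y ∈ X -> equinumerous (adj X y) (sc d).
Proof.
  intros [f Hf] Hy; pose proof Hf as [Hi _]; pose proof Hi as [Hf' _].
  set (F := fun x => ite (x = y) d (app f x)).
  assert (Fy : F y = d) by (unfold F; rewrite ite_true; auto).
  assert (Fx : forall x, x ∈ X -> F x = app f x)
    by (intros x Hx; unfold F; rewrite ite_false; auto; intros ->; auto).
  assert (Fm : forall x, x ∈ X -> app f x ∈ d) by (intros; eapply app_mem; eauto).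
  exists (lam (adj X y) F); apply lam_bijection.
  - unfold F; def.
  - intros x Hx; apply adj_spec in Hx; destruct Hx as [Hx| ->].
    + rewrite Fx; auto.
    + rewrite Fy; auto.
  - intros x x' Hx Hx' E; apply adj_spec in Hx, Hx'; destruct Hx as [Hx| ->], Hx' as [Hx'| ->]; auto.
    + rewrite !Fx in E; auto; eapply app_inj; eauto.
    + exfalso; rewrite Fy, Fx in E; auto; apply (mem_irrefl d); rewrite <- E at 1; auto.
    + exfalso; rewrite Fy, Fx in E; auto; apply (mem_irrefl d); rewrite E at 1; auto.
  - intros z Hz; apply sc_spec in Hz; destruct Hz as [Hz| ->].
    + destruct (app_surj f X d z) as (x & Hx & <-); auto.
      exists x; rewrite adj_spec; auto.
    + exists y; rewrite adj_spec; auto.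
Qed.

Lemma injection_adj (X k x : V) : ~ x ∈ X ->
  (exists g, is_injection g X k) -> exists g, is_injection g (adj X x) (sc k).
Proof.
  intros Hx [g Hg]; pose proof Hg as [Hf _].
  assert (Fm : forall x, x ∈ X -> app g x ∈ k) by (intros; eapply app_mem; eauto).
  set (F := fun z => ite (z = x) k (app g z)).
  assert (Fy : F x = k) by (unfold F; rewrite ite_true; auto).
  assert (Fx : forall z, z ∈ X -> F z = app g z)
    by (intros z Hz; unfold F; rewrite ite_false; auto; intros ->; auto).
  exists (lam (adj X x) F); apply lam_injection.
  - unfold F; def.
  - intros z Hz; apply adj_spec in Hz; destruct Hz as [Hz| ->].
    + rewrite Fx; auto.
    + rewrite Fy; auto.
  - intros z z' Hz Hz' E; apply adj_spec in Hz, Hz'; destruct Hz as [Hz| ->], Hz' as [Hz'| ->]; auto.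
    + rewrite !Fx in E; auto; eapply app_inj; eauto.
    + exfalso; rewrite Fy, Fx in E; auto; apply (mem_irrefl k); rewrite <- E at 1; auto.
    + exfalso; rewrite Fy, Fx in E; auto; apply (mem_irrefl k); rewrite E at 1; auto.
Qed.

(** Induction: given an injection of n+2 into n+1, drop the last argument and send the argument with
    value n, if any, to the value freed by this. *)
Lemma pigeonhole (n : V) : is_natural n -> ~ exists f, is_injection f (sc n) n.
Proof.
  revert n; apply (nat_induction (fun n => ~ exists f, is_injection f (sc n) n)).
  - def.
  - intros [f Hf]; apply (emp_spec (app f emp)), (app_mem f (sc emp)); [apply Hf | auto].
  - intros n Hn IH [f Hf]; apply IH.
    pose proof Hf as [Hf' _].
    assert (Fm : forall x, x ∈ sc (sc n) -> app f x ∈ sc n) by (intros; eapply app_mem; eauto).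
    assert (Fi : forall x y, x ∈ sc (sc n) -> y ∈ sc (sc n) -> app f x = app f y -> x = y)
      by (intros; eapply app_inj; eauto).
    assert (Fn : forall x, x ∈ sc n -> app f x <> app f (sc n)).
    { intros x Hx E; apply Fi in E; auto; subst; exact (mem_irrefl _ Hx). }
    exists (lam (sc n) (fun x => ite (app f x = n) (app f (sc n)) (app f x))).
    apply lam_injection.
    + def.
    + intros x Hx; destruct (classic (app f x = n)) as [E|E];
        [rewrite ite_true by auto | rewrite ite_false by auto].
      * assert (K : app f (sc n) ∈ sc n) by auto.
        apply sc_spec in K; destruct K as [K|K]; auto.
        destruct (Fn x Hx); congruence.
      * assert (K : app f x ∈ sc n) by auto.
        apply sc_spec in K; tauto.
    + intros x y Hx Hy.
      destruct (classic (app f x = n)) as [E|E];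
        [rewrite (ite_true (app f x = n)) by auto | rewrite (ite_false (app f x = n)) by auto];
        (destruct (classic (app f y = n)) as [E'|E'];
        [rewrite (ite_true (app f y = n)) by auto | rewrite (ite_false (app f y = n)) by auto]);
        intro K; try (apply Fi; auto; congruence); exfalso.
      * apply (Fn y Hy); auto.
      * apply (Fn x Hx); auto.
Qed.

(** If k < d, then k+1 is a subset of d, and restricting the injection contradicts the pigeonhole
    principle. *)
Lemma injection_le (d k : V) : is_natural d -> is_natural k ->
  (exists f, is_injection f d k) -> d ∈ sc k.
Proof.
  intros Hd Hk [f Hf].
  destruct (nat_trichotomy d k) as [H|[->|H]]; auto.
  exfalso; apply (pigeonhole k Hk).
  assert (S : forall x, x ∈ sc k -> x ∈ d).
  { intros x Hx; apply sc_spec in Hx; destruct Hx as [Hx| ->]; auto; eapply nat_trans; eauto. }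
  exists (lam (sc k) (fun x => app f x)); apply lam_injection.
  - def.
  - intros x Hx; apply (app_mem f d); auto; apply Hf.
  - intros x y Hx Hy; apply (app_inj f d k); auto.
Qed.

(** * Adding one element to small subsets injectively *)

(* Reading the elements of [U] as opening and the non-elements as closing
   brackets, [height U j] is the number of pending brackets before position [j]. *)
Definition height (U j : V) : V :=
  rec (fun _ => emp) (fun U i h => ite (i ∈ U) (sc h) (prd h)) U j.

Lemma F2_height : F2 height.
Proof. apply (F2_rec (fun _ => emp) (fun U i h => ite (i ∈ U) (sc h) (prd h))); def. Qed.
Hint Resolve F2_height : definable.

Lemma height_emp (U : V) : height U emp = emp.
Proof. apply (rec_emp (fun _ => emp)); def. Qed.

Lemma height_in (U j : V) : is_natural j -> j ∈ U -> height U (sc j) = sc (height U j).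
Proof.
  intros Hj H; unfold height; rewrite rec_sc by (auto || def); rewrite ite_true; auto.
Qed.

Lemma height_out (U j : V) : is_natural j -> ~ j ∈ U -> height U (sc j) = prd (height U j).
Proof.
  intros Hj H; unfold height; rewrite rec_sc by (auto || def); rewrite ite_false; auto.
Qed.

Lemma nat_height (U j : V) : is_natural j -> is_natural (height U j).
Proof.
  revert j; apply (nat_induction (fun j => is_natural (height U j))).
  - def.
  - rewrite height_emp; auto.
  - intros j Hj IH; destruct (classic (j ∈ U)) as [H|H].
    + rewrite height_in; auto.
    + rewrite height_out; auto.
      destruct (nat_cases _ IH) as [->|(m & Hm & ->)]; [rewrite prd_emp | rewrite prd_sc]; auto.
Qed.
Hint Resolve nat_height : core.

(** These are the positions of the unmatched closing brackets. *)
Definition free (N U i : V) : Prop := i ∈ N /\ ~ i ∈ U /\ height U i = emp.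

Lemma D3_free : D3 free.
Proof. unfold free; def. Qed.
Hint Resolve D3_free : definable.

Definition top (N U : V) : V := the (fun i => free N U i /\ forall j, free N U j -> j ∈ sc i).

Lemma F2_top : F2 top.
Proof. unfold top; def. Qed.
Hint Resolve F2_top : definable.

Lemma top_spec (N U : V) : is_natural N -> (exists i, free N U i) ->
  free N U (top N U) /\ forall j, free N U j -> j ∈ sc (top N U).
Proof.
  intros HN [i Hi]; apply (the_spec (fun i => free N U i /\ forall j, free N U j -> j ∈ sc i)).
  - destruct (nat_max N (free N U)) as (m & Hm & Fm & K); [def | auto | |].
    + exists i; split; auto; apply Hi.
    + exists m; split; auto; intros j Hj; apply K; auto; apply Hj.
  - intros y z [Hy Ky] [Hz Kz]; pose proof (Ky z Hz) as H; pose proof (Kz y Hy) as H'.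
    apply sc_spec in H, H'; destruct H as [H|H], H' as [H'|H']; auto.
    destruct (mem_asym _ _ H H').
Qed.

Section Flip.
Context (N U x : V) (HN : is_natural N) (Hx : free N U x)
  (Mx : forall j, free N U j -> j ∈ sc x).

Lemma nat_x : is_natural x.
Proof. apply (nat_mem N); auto; apply Hx. Qed.

(** The height at j depends only on the positions before j, and there the two sets agree. *)
Lemma height_adj_below (j : V) : is_natural j -> j ∈ sc x -> height (adj U x) j = height U j.
Proof.
  pose proof nat_x as Nx; revert j.
  apply (nat_induction (fun j => j ∈ sc x -> height (adj U x) j = height U j)).
  - def.
  - rewrite !height_emp; auto.
  - intros j Hj IH H; apply sc_mem_inv in H; auto.
    assert (j <> x) by (intros ->; exact (mem_irrefl _ H)).
    destruct (classic (j ∈ U)) as [K|K].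
    + rewrite !height_in, IH; auto; apply adj_spec; auto.
    + rewrite !height_out, IH; auto; rewrite adj_spec; tauto.
Qed.

(* No position above [x] is free, so the bracket opened at [x] is never closed. *)
Lemma height_adj_above (j : V) :
  is_natural j -> j ∈ sc N -> x ∈ j -> height (adj U x) j = sc (height U j).
Proof.
  pose proof nat_x as Nx; revert j.
  apply (nat_induction (fun j => j ∈ sc N -> x ∈ j -> height (adj U x) j = sc (height U j))).
  - def.
  - intros _ H; destruct (emp_spec _ H).
  - intros j Hj IH H H'; apply sc_mem_inv in H; auto.
    destruct (classic (x = j)) as [<-|E].
    + destruct Hx as (_ & K & Z).
      (* At x itself the height is zero: the new bracket raises it to one, while the old one keeps
         it at zero by truncation. *)
      rewrite height_in, height_out, height_adj_below by (auto; apply adj_spec; auto).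
      rewrite Z, prd_emp; reflexivity.
    + apply sc_spec in H'; destruct H' as [H'|H']; [|tauto].
      destruct (classic (j ∈ U)) as [K|K].
      * rewrite !height_in, IH; auto; apply adj_spec; auto.
      * rewrite !height_out, IH by (auto; rewrite adj_spec; intuition).
        (* At height zero the non-element j would be free and above x. So the height is a successor,
           and no truncation disturbs the difference of one. *)
        destruct (nat_cases (height U j)) as [Z|(m & _ & ->)]; auto.
        -- assert (L : j ∈ sc x) by (apply Mx; repeat split; auto).
           apply sc_spec in L; destruct L as [L|L]; [|congruence].
           destruct (mem_asym _ _ L H').
        -- rewrite !prd_sc; reflexivity.
Qed.

(** Beyond x the new height is a successor. Together with [zero_adj] this identifies x as the last
    zero, read off from [adj U x] alone. *)
Lemma last_zero_adj (j : V) : j ∈ N -> height (adj U x) j = emp -> j ∈ sc x.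
Proof.
  intros Hj Z; assert (is_natural j) by (eapply nat_mem; eauto).
  destruct (nat_trichotomy j x) as [H'|[->|H']]; auto using nat_x.
  rewrite height_adj_above in Z; auto; destruct (sc_neq_emp _ Z).
Qed.

Lemma zero_adj : height (adj U x) x = emp.
Proof. rewrite height_adj_below; auto using nat_x; apply Hx. Qed.

End Flip.

(** Both added elements are the last zero of the height of the common set, hence equal; removing it
    gives back [U] and [U']. *)
Lemma adj_top_inj (N U U' : V) : is_natural N ->
  (exists i, free N U i) -> (exists i, free N U' i) ->
  adj U (top N U) = adj U' (top N U') -> U = U' /\ top N U = top N U'.
Proof.
  intros HN H H' E.
  destruct (top_spec N U HN H) as [Hx Mx]; destruct (top_spec N U' HN H') as [Hx' Mx'].
  set (x := top N U) in *; set (x' := top N U') in *.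
  assert (K : x ∈ sc x').
  { apply (last_zero_adj N U' x' HN Hx' Mx'); [apply Hx|].
    rewrite <- E; eapply zero_adj; eauto. }
  assert (K' : x' ∈ sc x).
  { apply (last_zero_adj N U x HN Hx Mx); [apply Hx'|].
    rewrite E; eapply zero_adj; eauto. }
  assert (Ex : x = x').
  { apply sc_spec in K, K'; destruct K as [K|K], K' as [K'|K']; auto.
    destruct (mem_asym _ _ K K'). }
  clearbody x x'; subst x'; split; auto; apply ext; intro z.
  assert (L : z ∈ adj U x <-> z ∈ adj U' x) by (rewrite E; tauto).
  rewrite !adj_spec in L; destruct Hx as (_ & Hx & _), Hx' as (_ & Hx' & _).
  destruct (classic (z = x)) as [->|]; tauto.
Qed.

(* Without free positions every non-element closes a bracket, whence
   [j + height U j = 2 |U ∩ j|] for all [j <= N]. *)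
Lemma free_exists (U k : V) : is_natural k -> (exists g, is_injection g U k) ->
  exists i, free (sc (add k k)) U i.
Proof.
  intros Hk [g Hg]; set (N := sc (add k k)); apply NNPP; intro C.
  assert (HN : is_natural N) by (unfold N; auto).
  assert (DU : D1 (fun i => i ∈ U)) by def.
  assert (L : forall j, is_natural j -> j ∈ sc N -> exists d, is_natural d /\
    equinumerous (sep j (fun i => i ∈ U)) d /\ add j (height U j) = add d d).
  { apply (nat_induction (fun j => j ∈ sc N -> exists d, is_natural d /\
      equinumerous (sep j (fun i => i ∈ U)) d /\ add j (height U j) = add d d)).
    - unfold sep; def.
    - intros _; exists emp; rewrite height_emp; repeat split; auto.
      replace (sep emp (fun i => i ∈ U)) with emp; [apply equinumerous_emp|].
      apply ext; intro z; rewrite sep_spec by auto; split; [intro K|intros [K _]];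
        destruct (emp_spec _ K).
    - intros j Hj IH H; apply sc_mem_inv in H; auto.
      destruct IH as (d & Hd & Q & E); auto.
      destruct (classic (j ∈ U)) as [K|K].
      + exists (sc d); repeat split; auto.
        * replace (sep (sc j) (fun i => i ∈ U)) with (adj (sep j (fun i => i ∈ U)) j).
          -- apply equinumerous_adj; auto; rewrite sep_spec by auto.
             intros [M _]; exact (mem_irrefl _ M).
          -- apply ext; intro z; rewrite adj_spec, !sep_spec, sc_spec by auto.
             split; [intros [?| ->]; tauto | tauto].
        * rewrite height_in, !add_sc, !sc_add, E; auto.
      + exists d; repeat split; auto.
        * replace (sep (sc j) (fun i => i ∈ U)) with (sep j (fun i => i ∈ U)); auto.
          apply ext; intro z; rewrite !sep_spec, sc_spec by auto.
          split; [tauto | intros [[?| ->] ?]; tauto].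
        * rewrite height_out; auto.
          destruct (nat_cases (height U j)) as [Z|(m & Hm & Z)]; auto.
          (* A non-element at height zero would be free; otherwise, as in the next case, j grows by
             one while the height drops by one. *)
          -- destruct C; exists j; repeat split; auto.
          -- rewrite Z in E; rewrite Z, prd_sc, sc_add, <- E, add_sc; auto. }
  destruct (L N) as (d & Hd & Q & E); auto.
  assert (Hdk : d ∈ sc k).
  { apply injection_le; auto.
    apply equinumerous_sym in Q; destruct Q as [f [Hf _]].
    assert (Hs : is_injection (lam (sep N (fun i => i ∈ U)) (fun x => x)) (sep N (fun i => i ∈ U)) U).
    { apply lam_injection; auto; [def|]; intros x Hx; apply sep_spec in Hx; tauto. }
    destruct (injection_comp f _ _ _ _ Hf Hs) as [f' Hf'].
    exact (injection_comp f' g _ _ _ Hf' Hg). }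
  (* With d = |U ∩ N| the contradiction is N ≤ N + [height U N] = 2d ≤ 2k < N. *)
  assert (K : N ∈ sc (add d d)) by (rewrite <- E; apply le_add; auto).
  assert (K' : add d d ∈ N).
  { apply sc_spec in Hdk; destruct Hdk as [Hdk| ->]; [|unfold N; auto].
    apply mem_sc, double_lt; auto. }
  apply sc_spec in K; destruct K as [K|K].
  - exact (mem_asym _ _ K K').
  - rewrite <- K in K'; exact (mem_irrefl _ K').
Qed.

(** * Permutations moving a fixed number of points *)

(** An injection of [N] into [A] is not onto, as [A] is infinite, so one more point can be added.
    Only one point is picked per step of an existence proof, hence without choice. *)
Lemma infinite_injection (A : V) : infinite A ->
  forall N, is_natural N -> exists f, is_injection f N A.
Proof.
  intro HA; apply (nat_induction (fun N => exists f, is_injection f N A)).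
  - def.
  - exists (lam emp (fun x => x)); apply lam_injection; [def| |];
      intros y; intros; exfalso; eapply emp_spec; eauto.
  - intros N HN [f Hf]; pose proof Hf as [Hf' _].
    assert (K : exists a, a ∈ A /\ forall i, i ∈ N -> app f i <> a).
    { apply NNPP; intro C; apply HA; exists N; split; auto; apply equinumerous_sym.
      exists f; split; auto; intros y Hy; apply NNPP; intro C'; apply C.
      exists y; split; auto; intros i Hi E; apply C'; exists i.
      apply (maps_app f N A); auto. }
    destruct K as (a & Ha & K).
    set (F := fun i => ite (i = N) a (app f i)).
    assert (FN : F N = a) by (unfold F; rewrite ite_true; auto).
    assert (Fi : forall i, i ∈ N -> F i = app f i).
    { intros i Hi; unfold F; rewrite ite_false; auto; intros ->; exact (mem_irrefl _ Hi). }
    exists (lam (sc N) F); apply lam_injection.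
    + unfold F; def.
    + intros i Hi; apply sc_spec in Hi; destruct Hi as [Hi| ->]; [rewrite Fi|rewrite FN]; auto.
      apply (app_mem f N); auto.
    + intros i j Hi Hj E; apply sc_spec in Hi, Hj.
      destruct Hi as [Hi| ->], Hj as [Hj| ->]; rewrite ?FN, ?Fi in E by auto; auto.
      * apply (app_inj f N A); auto.
      * destruct (K i Hi E).
      * destruct (K j Hj (eq_sym E)).
Qed.

(** Raises the size bounds n, n+1 and n+2 met below to the common bound n+3. *)
Lemma injection_widen (X k : V) :
  (exists g, is_injection g X k) -> exists g, is_injection g X (sc k).
Proof.
  intros [g Hg]; assert (Hi : is_injection (lam k (fun x => x)) k (sc k)).
  { apply lam_injection; auto; def. }
  exact (injection_comp g _ _ _ _ Hg Hi).
Qed.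

Section Permutations.
Context (A : V).

Definition mov (s : V) : V := sep A (fun z => app s z <> z).

Lemma mov_spec (s z : V) : z ∈ mov s <-> z ∈ A /\ app s z <> z.
Proof. apply sep_spec; def. Qed.

Lemma is_mov_iff (s M : V) : is_function s A A -> (is_mov A s M <-> M = mov s).
Proof.
  intro Hs; unfold is_mov.
  assert (K : forall a, (a ∈ A /\ exists b, maps s a b /\ b <> a) <-> a ∈ mov s).
  { intro a; rewrite mov_spec; split.
    - intros [Ha (b & Hb & N)]; apply (maps_app s A A) in Hb; auto.
      destruct Hb as [_ ->]; auto.
    - intros [Ha N]; split; auto; exists (app s a); split; auto; apply (maps_app s A A); auto. }
  split.
  - intro H; apply ext; intro a; rewrite H; apply K.
  - intros -> a; symmetry; apply K.
Qed.

(** A Kuratowski pair of elements of [A] lies in [pow (pow A)], so the triple power set contains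
    every function from [A] to [A]. *)
Definition perms (n : V) : V :=
  sep (pow (pow (pow A))) (fun s => is_bijection s A A /\ equinumerous (mov s) n).

Lemma F1_mov : F1 mov.
Proof. unfold mov, sep; def. Qed.
Hint Resolve F1_mov : definable.

Lemma F1_perms : F1 perms.
Proof. unfold perms, sep; def. Qed.
Hint Resolve F1_perms : definable.

Lemma mem_perms (n s : V) : s ∈ perms n <-> is_bijection s A A /\ equinumerous (mov s) n.
Proof.
  unfold perms; rewrite sep_spec by def; split; [tauto|].
  intro H; split; auto; apply pow_spec; intros p Hp.
  destruct H as [[[(K & _) _] _] _]; destruct (K p Hp) as (x & y & Hx & Hy & E).
  apply is_opair_iff in E; subst p; apply pow_spec; intros u Hu; apply pow_spec; intros z Hz.
  apply upair_spec in Hu; destruct Hu as [->| ->]; apply upair_spec in Hz;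
    destruct Hz as [->| ->]; auto.
Qed.

Lemma perms_spec (n : V) : is_perms_moving n A (perms n).
Proof.
  intro s; rewrite mem_perms; split; intros [H K]; split; auto;
    assert (Hs : is_function s A A) by apply H.
  - exists (mov s); rewrite is_mov_iff; auto.
  - destruct K as (M & HM & K); apply is_mov_iff in HM; auto; subst; exact K.
Qed.

(* A 3-cycle, or, when [c = a], the transposition of [a] and [b], as the first test wins. *)
Definition cyc (a b c s z : V) : V :=
  ite (z = a) b (ite (z = b) c (ite (z = c) a (app s z))).

Lemma cyc_def (a b c s : V) : F1 (cyc a b c s).
Proof. unfold cyc; def. Qed.
Hint Resolve cyc_def : definable core.

(** * Composing a permutation with a cycle on points that it fixes *)

Section Cycle.
Context (a b c s : V) (Hs : is_bijection s A A) (Ha : a ∈ A) (Hb : b ∈ A) (Hc : c ∈ A)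
  (Sa : app s a = a) (Sb : app s b = b) (Sc : app s c = c) (ab : a <> b) (bc : b <> c).

Lemma cyc_a : cyc a b c s a = b.
Proof. unfold cyc; rewrite ite_true; auto. Qed.

Lemma cyc_b : cyc a b c s b = c.
Proof. unfold cyc; rewrite (ite_false (b = a)), ite_true; auto. Qed.

Lemma cyc_c : c <> a -> cyc a b c s c = a.
Proof. intro; unfold cyc; rewrite (ite_false (c = a)), (ite_false (c = b)), ite_true; auto. Qed.

Lemma cyc_other (z : V) : z <> a -> z <> b -> z <> c -> cyc a b c s z = app s z.
Proof. intros; unfold cyc; rewrite !ite_false; auto. Qed.

Lemma cyc_cases (z : V) :
  (z = a /\ cyc a b c s z = b) \/ (z = b /\ cyc a b c s z = c) \/
  (z = c /\ c <> a /\ cyc a b c s z = a) \/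
  (z <> a /\ z <> b /\ z <> c /\ cyc a b c s z = app s z).
Proof.
  destruct (classic (z = a)) as [->|]; [left; auto using cyc_a|].
  destruct (classic (z = b)) as [->|]; [right; left; auto using cyc_b|].
  destruct (classic (z = c)) as [->|]; [right; right; left; auto using cyc_c|].
  right; right; right; auto using cyc_other.
Qed.

Lemma app_s_inj (z z' : V) : z ∈ A -> z' ∈ A -> app s z = app s z' -> z = z'.
Proof. apply (app_inj s A A), Hs. Qed.

(** Since s fixes a, b and c, it permutes the remaining points, and the cycle permutes these. *)
Lemma cyc_bijection : is_bijection (lam A (cyc a b c s)) A A.
Proof.
  assert (Hm : forall z, z ∈ A -> app s z ∈ A) by (intros; apply (app_mem s A A); auto; apply Hs).
  assert (Na : forall z, z ∈ A -> z <> a -> app s z <> a)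
    by (intros z Hz N E; apply N, app_s_inj; congruence).
  assert (Nb : forall z, z ∈ A -> z <> b -> app s z <> b)
    by (intros z Hz N E; apply N, app_s_inj; congruence).
  assert (Nc : forall z, z ∈ A -> z <> c -> app s z <> c)
    by (intros z Hz N E; apply N, app_s_inj; congruence).
  apply lam_bijection; auto.
  - intros z Hz; destruct (cyc_cases z) as [(_ & ->)|[(_ & ->)|[(_ & _ & ->)|(_ & _ & _ & ->)]]]; auto.
  - intros z z' Hz Hz'.
    pose proof (Na z Hz); pose proof (Nb z Hz); pose proof (Nc z Hz).
    pose proof (Na z' Hz'); pose proof (Nb z' Hz'); pose proof (Nc z' Hz').
    destruct (cyc_cases z) as [(E & ->)|[(E & ->)|[(E & F & ->)|(N1 & N2 & N3 & ->)]]];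
    destruct (cyc_cases z') as [(E' & ->)|[(E' & ->)|[(E' & F' & ->)|(N1' & N2' & N3' & ->)]]];
    intro K; solve [congruence | exfalso; intuition congruence | apply app_s_inj; auto].
  - intros y Hy.
    (* The value c is treated before a: if c = a, this point is the image of b, and the case for a
       then has c and a distinct. *)
    destruct (classic (y = b)) as [->|]; [exists a; auto using cyc_a|].
    destruct (classic (y = c)) as [->|]; [exists b; auto using cyc_b|].
    destruct (classic (y = a)) as [->|]; [exists c; auto using cyc_c|].
    destruct (app_surj s A A y Hs Hy) as (z & Hz & <-); exists z; split; auto.
    apply cyc_other; congruence.
Qed.

Lemma cyc_moves (z : V) :
  cyc a b c s z <> z <-> ((app s z <> z \/ z = a) \/ z = b) \/ z = c.
Proof.
  destruct (cyc_cases z) as [(E & ->)|[(E & ->)|[(E & F & ->)|(N1 & N2 & N3 & ->)]]];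
    subst; intuition congruence.
Qed.

Lemma cyc_mov : mov (lam A (cyc a b c s)) = adj (adj (adj (mov s) a) b) c.
Proof.
  apply ext; intro z; rewrite !adj_spec, !mov_spec; split.
  - intros [Hz K]; rewrite app_lam in K by auto; apply cyc_moves in K; tauto.
  - intro K; assert (Hz : z ∈ A) by (destruct K as [[[K| ->]| ->]| ->]; tauto).
    split; auto; rewrite app_lam by auto; apply cyc_moves; tauto.
Qed.

End Cycle.

(** * The injection obtained from three indices, the third one left as a parameter [p3] *)

Section Step.
Context (n N f : V) (HN : is_natural N) (Hf : is_injection f N A).

Definition trace (s : V) : V := sep N (fun i => app s (app f i) <> app f i).

Lemma trace_spec (s i : V) : i ∈ trace s <-> i ∈ N /\ app s (app f i) <> app f i.
Proof. apply sep_spec; def. Qed.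

Lemma F1_trace : F1 trace.
Proof. unfold trace, sep; def. Qed.
Hint Resolve F1_trace : definable.

Definition next (u : V) : V := adj u (top N u).

Lemma F1_next : F1 next.
Proof. unfold next; def. Qed.
Hint Resolve F1_next : definable.

Context (p3 : V -> V) (Hp3 : F1 p3) (q : V).

Definition p1 (u : V) : V := top N u.
Definition p2 (u : V) : V := top N (next u).
(** Two elements are added when [p3] repeats [p1], and three when it is a further new index. *)
Definition grow (u : V) : V := adj (adj (adj u (p1 u)) (p2 u)) (p3 u).

Definition extend (s : V) : V :=
  lam A (cyc (app f (p1 (trace s))) (app f (p2 (trace s))) (app f (p3 (trace s))) s).

Context (free1 : forall s, s ∈ perms n -> exists i, free N (trace s) i)
  (free2 : forall s, s ∈ perms n -> exists i, free N (next (trace s)) i)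
  (new3 : forall s, s ∈ perms n -> let u := trace s in
     p3 u ∈ N /\ ~ p3 u ∈ u /\ p3 u <> p2 u)
  (card : forall s, s ∈ perms n -> let u := trace s in
     equinumerous (adj (adj (adj (mov s) (app f (p1 u))) (app f (p2 u))) (app f (p3 u))) q)
  (grow_inj : forall s s', s ∈ perms n -> s' ∈ perms n ->
     grow (trace s) = grow (trace s') -> trace s = trace s').

Lemma p1_spec (s : V) : s ∈ perms n -> p1 (trace s) ∈ N /\ ~ p1 (trace s) ∈ trace s.
Proof.
  intro Hs; destruct (top_spec N (trace s) HN (free1 s Hs)) as [(H & K & _) _]; auto.
Qed.

Lemma p2_spec (s : V) : s ∈ perms n ->
  p2 (trace s) ∈ N /\ ~ p2 (trace s) ∈ trace s /\ p1 (trace s) <> p2 (trace s).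
Proof.
  intro Hs; destruct (top_spec N (next (trace s)) HN (free2 s Hs)) as [(H & K & _) _].
  unfold next in K at 2; rewrite adj_spec in K; unfold p1, p2; intuition.
Qed.

Lemma app_f_mem (i : V) : i ∈ N -> app f i ∈ A.
Proof. apply app_mem, Hf. Qed.

Lemma app_f_inj (i j : V) : i ∈ N -> j ∈ N -> app f i = app f j -> i = j.
Proof. apply (app_inj f N A), Hf. Qed.

Lemma trace_fixed (s i : V) : i ∈ N -> ~ i ∈ trace s -> app s (app f i) = app f i.
Proof. intros Hi K; apply NNPP; intro C; apply K, trace_spec; auto. Qed.

(** The cycle moves just the points of the three indices, and f is injective; so exactly these
    indices join the trace. *)
Lemma extend_spec (s : V) : s ∈ perms n ->
  extend s ∈ perms q /\ trace (extend s) = grow (trace s).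
Proof.
  intro Hs; pose proof (p1_spec s Hs) as (I1 & O1); pose proof (p2_spec s Hs) as (I2 & O2 & N12).
  pose proof (new3 s Hs) as K3; cbv zeta in K3; destruct K3 as (I3 & O3 & N3).
  pose proof (card s Hs) as C; cbv zeta in C.
  apply mem_perms in Hs; destruct Hs as [Bs _].
  assert (N12' : app f (p1 (trace s)) <> app f (p2 (trace s)))
    by (intro E; apply app_f_inj in E; auto).
  assert (N3' : app f (p2 (trace s)) <> app f (p3 (trace s)))
    by (intro E; apply app_f_inj in E; auto).
  split.
  - apply mem_perms; unfold extend; split.
    + apply cyc_bijection; auto using app_f_mem, trace_fixed.
    + rewrite cyc_mov; auto using app_f_mem, trace_fixed.
  - apply ext; intro i; unfold grow; rewrite !adj_spec, !trace_spec.
    unfold extend; split.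
    + intros [Hi K]; rewrite app_lam in K by auto using app_f_mem.
      apply cyc_moves in K; auto using trace_fixed.
      destruct K as [[[K|K]|K]|K]; [tauto| | |]; apply app_f_inj in K; tauto.
    + intro K; assert (Hi : i ∈ N) by (destruct K as [[[K| ->]| ->]| ->]; tauto).
      split; auto; rewrite app_lam by auto using app_f_mem; apply cyc_moves; auto using trace_fixed.
      destruct K as [[[[_ K]| ->]| ->]| ->]; auto.
Qed.

(** The grown trace determines the trace and thereby the cycle. On the points of the cycle s and s'
    are the identity; elsewhere they agree with their extensions. *)
Lemma extend_inj (s s' : V) : s ∈ perms n -> s' ∈ perms n -> extend s = extend s' -> s = s'.
Proof.
  intros Hs Hs' E.
  assert (T : trace s = trace s').
  { apply grow_inj; auto; rewrite <- (proj2 (extend_spec s Hs)), <- (proj2 (extend_spec s' Hs')).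
    congruence. }
  pose proof (p1_spec s Hs) as (I1 & O1); pose proof (p2_spec s Hs) as (I2 & O2 & N12).
  pose proof (new3 s Hs) as K3; cbv zeta in K3; destruct K3 as (I3 & O3 & N3).
  apply mem_perms in Hs, Hs'; destruct Hs as [Bs _], Hs' as [Bs' _].
  apply (function_ext s s' A A); [apply Bs | apply Bs' |].
  intros z Hz.
  assert (K : forall i, i ∈ N -> ~ i ∈ trace s -> z = app f i -> app s z = app s' z).
  { intros i Hi Oi ->; rewrite !trace_fixed; auto; congruence. }
  destruct (classic (z = app f (p1 (trace s)))) as [|M1]; [eauto|].
  destruct (classic (z = app f (p2 (trace s)))) as [|M2]; [eauto|].
  destruct (classic (z = app f (p3 (trace s)))) as [|M3]; [eauto|].
  assert (L : app (extend s) z = app (extend s') z) by congruence.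
  unfold extend in L; rewrite <- T, !app_lam, !cyc_other in L; auto.
Qed.

Lemma perms_injection : exists g, is_injection g (perms n) (perms q).
Proof.
  exists (lam (perms n) extend); apply lam_injection.
  - unfold extend, lam, cyc, p1, p2; def.
  - intros s Hs; apply extend_spec, Hs.
  - exact extend_inj.
Qed.

End Step.

(** * The two instances, adding two and three moved points *)

Section Small.
Context (n N f : V) (Hn : is_natural n) (Hf : is_injection f N A)
  (EN : N = sc (add (sc (sc (sc n))) (sc (sc (sc n))))).

(** The length [N] is 2(n+3)+1, for which [free_exists] covers all sets of size at most n+3. *)
Lemma small_free (u : V) :
  (exists g, is_injection g u (sc (sc (sc n)))) -> exists i, free N u i.
Proof. intro H; rewrite EN; apply free_exists; auto. Qed.

Lemma nat_N : is_natural N.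
Proof. rewrite EN; auto 10. Qed.

Lemma small_next (u k : V) : (exists i, free N u i) ->
  (exists g, is_injection g u k) -> exists g, is_injection g (next N u) (sc k).
Proof.
  intros Hu; apply injection_adj.
  destruct (top_spec N u nat_N Hu) as [(_ & K & _) _]; exact K.
Qed.

(** The map f embeds the trace into the set of moved points. *)
Lemma small_trace (s : V) : s ∈ perms n -> exists g, is_injection g (trace N f s) n.
Proof.
  intro Hs; apply mem_perms in Hs; destruct Hs as [_ [h [Hh _]]].
  assert (Hi : is_injection (lam (trace N f s) (app f)) (trace N f s) (mov s)).
  { apply lam_injection.
    - def.
    - intros i Hi; apply trace_spec in Hi; apply mov_spec; split; [|tauto].
      apply (app_mem f N A); [apply Hf | tauto].
    - intros i j Hi Hj; apply trace_spec in Hi, Hj; apply (app_inj f N A); tauto. }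
  exact (injection_comp _ h _ _ _ Hi Hh).
Qed.

(** The three sets have at most n, n+1 and n+2 elements, each within the bound n+3. *)
Lemma trace_free (s : V) : s ∈ perms n -> let u := trace N f s in
  (exists i, free N u i) /\ (exists i, free N (next N u) i) /\
  (exists i, free N (next N (next N u)) i).
Proof.
  intros Hs u; pose proof (small_trace s Hs) as S0; fold u in S0.
  assert (F0 : exists i, free N u i) by auto using small_free, injection_widen.
  pose proof (small_next u n F0 S0) as S1.
  assert (F1 : exists i, free N (next N u) i) by auto using small_free, injection_widen.
  pose proof (small_next _ _ F1 S1) as S2.
  auto using small_free, injection_widen.
Qed.

Lemma moved_iff (s i : V) : i ∈ N -> (app f i ∈ mov s <-> i ∈ trace N f s).
Proof.
  intro Hi; rewrite mov_spec, trace_spec; assert (app f i ∈ A) by (apply (app_f_mem N); auto).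
  tauto.
Qed.

(** New indices give distinct points that s fixes, so each adds one to the cardinality. The first
    conjunct serves the transposition, the second the 3-cycle. *)
Lemma adj_distinct_card (s i j k : V) (Hs : s ∈ perms n) : let u := trace N f s in
  i ∈ N -> ~ i ∈ u -> j ∈ N -> ~ j ∈ adj u i ->
  equinumerous (adj (adj (mov s) (app f i)) (app f j)) (sc (sc n)) /\
  (k ∈ N -> ~ k ∈ adj (adj u i) j ->
   equinumerous (adj (adj (adj (mov s) (app f i)) (app f j)) (app f k)) (sc (sc (sc n)))).
Proof.
  intros u Hi Oi Hj Oj; apply mem_perms in Hs; destruct Hs as [_ C].
  assert (L : equinumerous (adj (adj (mov s) (app f i)) (app f j)) (sc (sc n))).
  { apply equinumerous_adj; [apply equinumerous_adj; auto|].
    - rewrite moved_iff; auto.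
    - rewrite adj_spec, moved_iff by auto; intros [K|K]; apply Oj, adj_spec; auto.
      right; apply (app_f_inj N f Hf); auto. }
  split; auto; intros Hk Ok; apply equinumerous_adj; auto.
  rewrite !adj_spec, moved_iff by auto; intro K; apply Ok; rewrite !adj_spec.
  destruct K as [[K|K]|K]; auto; apply (app_f_inj N f Hf) in K; auto.
Qed.

(** With [p3] equal to [top N] the third index is the first again: the cycle is a transposition, and
    by [Hd] the repeated insertion collapses. *)
Lemma perms_injection2 : exists g, is_injection g (perms n) (perms (sc (sc n))).
Proof.
  pose proof nat_N as HN.
  assert (Hd : forall u a b : V, adj (adj (adj u a) b) a = adj (adj u a) b).
  { intros u a b; apply ext; intro z; rewrite !adj_spec; tauto. }
  apply (perms_injection n N f HN Hf (top N)).
  - def.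
  - intros s Hs; apply trace_free, Hs.
  - intros s Hs; apply trace_free, Hs.
  - intros s Hs u; destruct (trace_free s Hs) as (T1 & T2 & _).
    destruct (top_spec N _ HN T1) as [(I1 & O1 & _) _].
    destruct (top_spec N _ HN T2) as [(I2 & O2 & _) _].
    repeat split; auto; intro E; apply O2, adj_spec; right; symmetry; exact E.
  - intros s Hs u; destruct (trace_free s Hs) as (T1 & T2 & _).
    destruct (top_spec N _ HN T1) as [(I1 & O1 & _) _].
    destruct (top_spec N _ HN T2) as [(I2 & O2 & _) _].
    (* [emp] is a placeholder for a third index, as only the first conjunct is taken. *)
    unfold p1; rewrite Hd; exact (proj1 (adj_distinct_card s _ _ emp Hs I1 O1 I2 O2)).
  - intros s s' Hs Hs'; unfold grow, p1; rewrite !Hd; intro E.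
    destruct (trace_free s Hs) as (T1 & T2 & _), (trace_free s' Hs') as (T1' & T2' & _).
    apply adj_top_inj in E; auto; destruct E as [E _].
    apply adj_top_inj in E; tauto.
Qed.

(** The third index comes from a third bracket step, so [grow] unfolds to [next] applied three times
    and is undone one step at a time. *)
Lemma perms_injection3 : exists g, is_injection g (perms n) (perms (sc (sc (sc n)))).
Proof.
  pose proof nat_N as HN.
  apply (perms_injection n N f HN Hf (fun u => top N (next N (next N u)))).
  - unfold next; def.
  - intros s Hs; apply trace_free, Hs.
  - intros s Hs; apply trace_free, Hs.
  - intros s Hs u; destruct (trace_free s Hs) as (T1 & T2 & T3).
    destruct (top_spec N _ HN T3) as [(I3 & O3 & _) _].
    fold u in I3, O3.
    assert (O : forall z, ~ z ∈ next N (next N u) -> ~ z ∈ u /\ z <> p2 N u).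
    { intro z; change (next N (next N u)) with (adj (adj u (top N u)) (p2 N u)).
      rewrite !adj_spec; tauto. }
    exact (conj I3 (O _ O3)).
  - intros s Hs u; destruct (trace_free s Hs) as (T1 & T2 & T3).
    destruct (top_spec N _ HN T1) as [(I1 & O1 & _) _].
    destruct (top_spec N _ HN T2) as [(I2 & O2 & _) _].
    destruct (top_spec N _ HN T3) as [(I3 & O3 & _) _].
    exact (proj2 (adj_distinct_card s _ _ _ Hs I1 O1 I2 O2) I3 O3).
  - intros s s' Hs Hs' E.
    destruct (trace_free s Hs) as (T1 & T2 & T3), (trace_free s' Hs') as (T1' & T2' & T3').
    apply adj_top_inj in E; auto; destruct E as [E _].
    apply adj_top_inj in E; auto; destruct E as [E _].
    apply adj_top_inj in E; tauto.
Qed.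

End Small.

(** * Composition of the steps by two and three *)

Lemma perms_injection_add2 (HA : infinite A) (n j : V) : is_natural n -> is_natural j ->
  n ∈ sc j -> exists g, is_injection g (perms n) (perms (sc (sc j))).
Proof.
  assert (S2 : forall n, is_natural n -> exists g, is_injection g (perms n) (perms (sc (sc n)))).
  { intros k Hk; destruct (infinite_injection A HA (sc (add (sc (sc (sc k))) (sc (sc (sc k))))))
      as [f Hf]; auto 10.
    exact (perms_injection2 k _ f Hk Hf eq_refl). }
  assert (S3 : forall n, is_natural n -> exists g, is_injection g (perms n) (perms (sc (sc (sc n))))).
  { intros k Hk; destruct (infinite_injection A HA (sc (add (sc (sc (sc k))) (sc (sc (sc k))))))
      as [f Hf]; auto 10.
    exact (perms_injection3 k _ f Hk Hf eq_refl). }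
  intros Hn Hj.
  (* Every difference of at least 2 is 2 or 3 plus a multiple of 2. The targets j+2 and j+3 are
     carried together, so that the induction can advance by two. *)
  assert (K : (n ∈ sc j -> exists g, is_injection g (perms n) (perms (sc (sc j)))) /\
    (n ∈ sc (sc j) -> exists g, is_injection g (perms n) (perms (sc (sc (sc j)))))); [|tauto].
  revert j Hj; apply (nat_induction (fun j =>
    (n ∈ sc j -> exists g, is_injection g (perms n) (perms (sc (sc j)))) /\
    (n ∈ sc (sc j) -> exists g, is_injection g (perms n) (perms (sc (sc (sc j))))))).
  - def.
  - assert (E : n ∈ sc emp -> n = emp).
    { intro H; apply sc_spec in H; destruct H as [H|H]; auto; destruct (emp_spec _ H). }
    split; intro H.
    + rewrite (E H); auto.
    + apply sc_spec in H; destruct H as [H| ->]; auto; rewrite (E H); auto.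
  - intros j Hj [IH1 IH2]; split; auto; intro H.
    apply sc_spec in H; destruct H as [H| ->]; auto.
    apply sc_spec in H; destruct H as [H| ->]; auto.
    (* For n ≤ j the injection into level j+2 is followed by the step from j+2 to j+4; n = j+2 and n
       = j+1 were single steps. *)
    destruct (IH1 H) as [g Hg], (S2 (sc (sc j))) as [g' Hg']; auto.
    exact (injection_comp g g' _ _ _ Hg Hg').
Qed.

End Permutations.
End SetTheory.

(** * Return to the relational notions of the statement *)

Theorem theorem4p1 (V : set_structure) (HZF : ZF V) (A m n : V)
  (HA : infinite A) (Hm : is_natural m) (Hn : is_natural n)
  (Hmn : add2_le n m) :
  exists Sn Sm f : V,
    is_perms_moving n A Sn /\ is_perms_moving m A Sm /\ is_injection f Sn Sm.
Proof.
  destruct Hmn as (n1 & n2 & H1 & H2 & H).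
  apply (is_succ_iff HZF) in H1, H2; subst n1 n2.
  (* Two predecessors are taken of m, giving m = j+2 with n ≤ j; the cases m = 0 and m = 1
     contradict n+2 ≤ m. *)
  assert (K : exists j, is_natural j /\ n ∈ sc HZF j /\ m = sc HZF (sc HZF j)).
  { destruct (nat_cases HZF m Hm) as [->|(m1 & Hm1 & ->)].
    - destruct H as [H|H]; [destruct (emp_spec HZF _ H) | destruct (sc_neq_emp HZF _ H)].
    - assert (L : sc HZF n ∈ sc HZF m1).
      { destruct H as [H|H]; [|apply (sc_inj HZF) in H; rewrite H; apply mem_sc_self].
        apply mem_sc, (sc_mem_inv HZF); auto. }
      destruct (nat_cases HZF m1 Hm1) as [->|(j & Hj & ->)].
      + apply (sc_mem_inv HZF) in L; [destruct (emp_spec HZF _ L) | apply nat_emp].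
      + exists j; repeat split; auto; apply (sc_mem_inv HZF (sc HZF j)); auto. }
  destruct K as (j & Hj & Hnj & ->).
  destruct (perms_injection_add2 HZF A HA n j Hn Hj Hnj) as [g Hg].
  exists (perms HZF A n), (perms HZF A (sc HZF (sc HZF j))), g.
  split; [|split]; auto; apply perms_spec.
Qed.
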